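(* Let $E\subset\mathbb{R}^3$ be a convex, cuboidal hexahedron with faces $f_0,\dots,f_5$ and outer unit normal $\nu$, and let $\ell,m\ge 0$ be integers with $n:=\ell+m\ge 1$. For each face $f_i$, $i=0,\dots,5$, with local face variables $(x_{a},x_{b})$ (two of the Cartesian coordinates of $\mathbb{R}^3$ that restrict to coordinates on $f_i$), there exist a polynomial vector function $\hat\sigma^i_{\ell,m}$ on $\hat E=[0,1]^3$ and a constant $c^i_{\ell,m}$ such that $\sigma^i_{\ell,m}:=\mathcal{P}_E\hat\sigma^i_{\ell,m}$ (the Piola transform) satisfies $$\nabla\cdot\sigma^i_{\ell,m}=0\ \text{ in }E,\qquad \sigma^i_{\ell,m}\cdot\nu=\begin{cases}x_{a}^\ell x_{b}^m-c^i_{\ell,m}&\text{on }f_i,\\ 0&\text{on }f_k,\ k\ne i.\end{cases}$$ Explicitly, for face $i=1$ (the image of $\hat x_1=1$) one may take $$\hat\sigma^1_{\ell,m}=\sum_{p=0}^{n+1}\sum_{q=0}^{n+1}\alpha^{\ell,m}_{pq}\hat\psi^1_{p,q}-\frac{\alpha^{\ell,m}_{00}}{|f_1|}\,\hat\sigma^1_{0,0},\qquad \hat\sigma^1_{0,0}=\sum_{p=0}^1\sum_{q=0}^1\alpha^{0,0}_{pq}\hat\psi^1_{p,q},$$ where $|f_1|$ is the area of $f_1$, the functions $\hat\psi^1_{p,q}$ are $$\hat\psi^1_{0,0}=\begin{pmatrix}\hat x_1\\0\\0\end{pmatrix},\qquad \hat\psi^1_{p,q}=\begin{pmatrix}\hat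 x_1\hat x_2^p\hat x_3^q-\dfrac{\hat x_1}{(p+1)(q+1)}\\[6pt] \dfrac{1}{2(p+1)}\hat x_2(1-\hat x_2^p)\Big(\hat x_3^q+\dfrac1{q+1}\Big)\\[6pt] \dfrac{1}{2(q+1)}\hat x_3(1-\hat x_3^q)\Big(\hat x_2^p+\dfrac1{p+1}\Big)\end{pmatrix}\quad(p+q\ge1),$$ and, for any $\ell,m\ge0$ with $n=\ell+m$, the coefficients $\alpha^{\ell,m}_{pq}$ are determined by expanding, as a polynomial in $(\hat x_2,\hat x_3)$, $$K_1\,x_{a}^\ell x_{b}^m=\alpha^{\ell,m}_{00}+\sum_{\substack{0\le p,q\le n+1\\ p+q\ge1}}\alpha^{\ell,m}_{pq}\Big(\hat x_2^p\hat x_3^q-\frac1{(p+1)(q+1)}\Big),$$ with $K_1$ the face Jacobian of face 1 and $x_{a},x_{b}$ evaluated as the corresponding components of $F_E(1,\hat x_2,\hat x_3)$.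
   Context: A convex, cuboidal hexahedron $E$ is a (nondegenerate) convex polyhedron in $\mathbb{R}^3$, combinatorially a cube, with six flat quadrilateral faces $f_0,\dots,f_5$, where $f_{2k}$ and $f_{2k+1}$ ($k=0,1,2$) are opposite, and vertices $\mathbf{x}_{ijk}=f_i\cap f_j\cap f_k$, $i\in\{0,1\}$, $j\in\{2,3\}$, $k\in\{4,5\}$. The reference cube is $\hat E=[0,1]^3$, with face $\hat f_{2k}$ lying in $\hat x_{k+1}=0$ and face $\hat f_{2k+1}$ lying in $\hat x_{k+1}=1$, and vertices $\hat{\mathbf{x}}_{ijk}=\hat f_i\cap\hat f_j\cap\hat f_k$. The map $F_E:\hat E\to E$ is the trilinear map (degree at most 1 in each variable) with $F_E(\hat{\mathbf{x}}_{ijk})=\mathbf{x}_{ijk}$. It is a bijection with $F_E(\hat f_i)=f_i$, and the labelling is such that $J_E:=\det DF_E>0$. Piola transform: $\mathcal{P}_E(\hat{\mathbf{v}})(\mathbf{x})=\frac{1}{J_E(\hat{\mathbf{x}})}DF_E(\hat{\mathbf{x}})\,\hat{\mathbf{v}}(\hat{\mathbf{x}})$, where $\mathbf{x}=F_E(\hat{\mathbf{x}})$. Face Jacobian: $K_1(\hat x_2,\hat x_3)=\Big\|\frac{\partial F_E}{\partial\hat x_2}\times\frac{\partial F_E}{\partial\hat x_3}\Big\|$ evaluated at $\hat x_1=1$. It is a polynomial of degree at most 1 in each of $\hat x_2,\hat x_3$, because the face is flat. *)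

(* Defs.v *)
From HB Require Import structures.
From mathcomp Require Import all_boot all_order all_algebra.
From mathcomp Require Import all_classical all_reals all_analysis.
From mathcomp Require mpoly.

Set Implicit Arguments.
Unset Strict Implicit.
Unset Printing Implicit Defensive.

Import Order.TTheory GRing.Theory Num.Theory.
Import numFieldNormedType.Exports.

Local Open Scope classical_set_scope.
Local Open Scope ring_scope.

(* Points and vectors of R^3 are row vectors 'rV[R]_3.  The canonical norm of
   'rV[R]_3 in the library is the sup norm; it is used below for the topology
   only, and Euclidean quantities go through dot and enorm. *)

Section Vectors.
Context {R : realType}.
Implicit Types u v : 'rV[R]_3.

Definition vec3 (a b c : R) : 'rV[R]_3 := \row_j [:: a; b; c]`_j.

Definition dot u v : R := \sum_j u 0 j * v 0 j.

Definition enorm u : R := Num.sqrt (dot u u).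

Definition cross u v : 'rV[R]_3 :=
  vec3 (u 0 1 * v 0 2 - u 0 2 * v 0 1)
       (u 0 2 * v 0 0 - u 0 0 * v 0 2)
       (u 0 0 * v 0 1 - u 0 1 * v 0 0).

Definition basis_vec (j : 'I_3) : 'rV[R]_3 := delta_mx 0 j.

Definition divergence (v : 'rV[R]_3 -> 'rV[R]_3) (x : 'rV[R]_3) : R :=
  \sum_j ('D_(basis_vec j) v x) 0 j.

Definition polynomial_field (v : 'rV[R]_3 -> 'rV[R]_3) : Prop :=
  exists P : 'I_3 -> mpoly.mpoly 3 R,
    forall x, v x = \row_j mpoly.meval (fun k => x 0 k) (P j).

(* Area of the surface parametrised injectively by r on the unit square: the
   surface integral of 1. *)
Definition surface_area (r : R -> R -> 'rV[R]_3) : R :=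
  \int[lebesgue_measure]_(s in `[0, 1]) (\int[lebesgue_measure]_(t in `[0, 1])
    enorm (cross (derive1 (fun s' => r s' t) s) (derive1 (fun t' => r s t') t))).

(* The reference cube; its faces 2k and 2k+1 lie in the planes where the
   coordinate of (0-based) index k is 0 and 1. *)
Definition ref_cube : set 'rV[R]_3 := [set x | forall j, 0 <= x 0 j <= 1].

Definition ref_face (i : 'I_6) : set 'rV[R]_3 :=
  [set x | ref_cube x /\ x 0 (inord i./2) = (odd i)%:R].

(* E cut by all the f i with i in I.  When the f i are the facets of a polytope
   E, these sets are exactly the faces of E (I empty gives E itself). *)
Definition face_meet (E : set 'rV[R]_3) (f : 'I_6 -> set 'rV[R]_3)
    (I : {set 'I_6}) : set 'rV[R]_3 :=
  [set x | E x /\ forall i, i \in I -> f i x].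

End Vectors.

Definition polyhedron (R : realType) (nu : 'I_6 -> 'rV[R]_3) (h : 'I_6 -> R) :
    set 'rV[R]_3 := [set x | forall i, dot (nu i) x <= h i].

Definition polyhedron_face (R : realType) (nu : 'I_6 -> 'rV[R]_3)
    (h : 'I_6 -> R) (i : 'I_6) : set 'rV[R]_3 :=
  [set x | polyhedron nu h x /\ dot (nu i) x = h i].

(* A nondegenerate convex polyhedron with six faces, with unit outer normals,
   combinatorially a cube: mapping the face i of the reference cube to the
   face i of the polyhedron induces an isomorphism of face lattices.
   hex_vertex i j k is the vertex common to the faces i, 2 + j and 4 + k, where
   the booleans stand for 0 and 1. *)
Record hexahedron (R : realType) := Hexahedron {
  hex_normal : 'I_6 -> 'rV[R]_3;
  hex_offset : 'I_6 -> R;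
  hex_vertex : bool -> bool -> bool -> 'rV[R]_3;
  hex_normal_unit : forall i, enorm (hex_normal i) = 1;
  hex_bounded : bounded_set (polyhedron hex_normal hex_offset);
  hex_solid : interior (polyhedron hex_normal hex_offset) !=set0;
  hex_combinatorial_cube : forall I J : {set 'I_6},
    face_meet (polyhedron hex_normal hex_offset)
      (polyhedron_face hex_normal hex_offset) I `<=`
    face_meet (polyhedron hex_normal hex_offset)
      (polyhedron_face hex_normal hex_offset) J
    <->
    face_meet (@ref_cube R) (@ref_face R) I `<=`
    face_meet (@ref_cube R) (@ref_face R) J;
  hex_vertexE : forall i j k : bool,
    polyhedron_face hex_normal hex_offset (inord i) `&`
    polyhedron_face hex_normal hex_offset (inord (2 + j)) `&`
    polyhedron_face hex_normal hex_offset (inord (4 + k)) =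
    [set hex_vertex i j k]
}.

Section Hexahedra.
Context {R : realType}.
Variable H : hexahedron R.

Definition hex_set : set 'rV[R]_3 := polyhedron (hex_normal H) (hex_offset H).

Definition hex_face (i : 'I_6) : set 'rV[R]_3 :=
  polyhedron_face (hex_normal H) (hex_offset H) i.

(* The Cartesian coordinates of indices a and b restrict to coordinates on the
   face i. *)
Definition face_coordinates (i : 'I_6) (a b : 'I_3) : Prop :=
  a != b /\ forall x y, hex_face i x -> hex_face i y ->
    x 0 a = y 0 a -> x 0 b = y 0 b -> x = y.

Definition lin_weight (e : bool) (t : R) : R := if e then t else 1 - t.

Definition hex_map (x : 'rV[R]_3) : 'rV[R]_3 :=
  \sum_(i : bool) \sum_(j : bool) \sum_(k : bool)
    (lin_weight i (x 0 0) * lin_weight j (x 0 1) * lin_weight k (x 0 2))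
      *: hex_vertex H i j k.

Lemma hex_map_vertex (i j k : bool) :
  hex_map (vec3 i%:R j%:R k%:R) = hex_vertex H i j k.
Proof.
rewrite /hex_map /vec3 !big_bool !mxE /lin_weight /=.
by case: i; case: j; case: k;
  rewrite /= ?subrr ?subr0 ?mulr0 ?mul0r ?mulr1 ?scale0r ?scale1r ?addr0 ?add0r.
Qed.

(* The library's jacobian acts on row vectors, v *m jacobian f x being the
   directional derivative of f along v; it is the transpose of the column
   convention for D f. *)
Definition hex_jac (x : 'rV[R]_3) : R := \det (jacobian hex_map x).

(* The reference point of x is its preimage under hex_map, a bijection from the
   reference cube onto the hexahedron when hex_jac > 0. *)
Definition hex_ref_point (x : 'rV[R]_3) : 'rV[R]_3 :=
  xget 0 [set xh | ref_cube xh /\ hex_map xh = x].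

Definition piola (v : 'rV[R]_3 -> 'rV[R]_3) (x : 'rV[R]_3) : 'rV[R]_3 :=
  let xh := hex_ref_point x in
  (hex_jac xh)^-1 *: (v xh *m jacobian hex_map xh).

Definition divergence_free (sigma : 'rV[R]_3 -> 'rV[R]_3) : Prop :=
  forall x, interior hex_set x ->
    differentiable sigma x /\ divergence sigma x = 0.

(* On edges, where two normals compete, the conditions of both faces are
   required. *)
Definition normal_flux_condition (i : 'I_6) (a b : 'I_3) (l m : nat) (c : R)
    (sigma : 'rV[R]_3 -> 'rV[R]_3) : Prop :=
  (forall x, hex_face i x ->
     dot (sigma x) (hex_normal H i) = x 0 a ^+ l * x 0 b ^+ m - c) /\
  (forall k x, k != i -> hex_face k x -> dot (sigma x) (hex_normal H k) = 0).

Definition face1_jac (s t : R) : R :=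
  enorm (cross ('D_(basis_vec 1) hex_map (vec3 1 s t))
               ('D_(basis_vec 2) hex_map (vec3 1 s t))).

Definition face1_area : R := surface_area (fun s t => hex_map (vec3 1 s t)).

Definition psi1 (p q : nat) (x : 'rV[R]_3) : 'rV[R]_3 :=
  if (p + q == 0)%N then vec3 (x 0 0) 0 0 else
  vec3 (x 0 0 * x 0 1 ^+ p * x 0 2 ^+ q - x 0 0 / (p.+1%:R * q.+1%:R))
       (1 / (2 * p.+1%:R) * x 0 1 * (1 - x 0 1 ^+ p)
          * (x 0 2 ^+ q + 1 / q.+1%:R))
       (1 / (2 * q.+1%:R) * x 0 2 * (1 - x 0 2 ^+ q)
          * (x 0 1 ^+ p + 1 / p.+1%:R)).

(* The expansion is an identity of polynomials on the unit square; outside of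
   it, face1_jac, being a norm, need not be polynomial. *)
Definition face1_expansion (a b : 'I_3) (l m : nat)
    (alpha : 'M[R]_((l + m).+2)) : Prop :=
  forall s t : R, 0 <= s <= 1 -> 0 <= t <= 1 ->
    let y := hex_map (vec3 1 s t) in
    face1_jac s t * (y 0 a ^+ l * y 0 b ^+ m) =
    alpha 0 0 +
    \sum_(p < (l + m).+2) \sum_(q < (l + m).+2 | (0 < p + q)%N)
      alpha p q * (s ^+ p * t ^+ q - 1 / (p.+1%:R * q.+1%:R)).

Definition psi1_comb (n : nat) (alpha : 'M[R]_(n.+2)) (x : 'rV[R]_3) :
    'rV[R]_3 :=
  \sum_(p < n.+2) \sum_(q < n.+2) alpha p q *: psi1 p q x.

Definition sigma1_hat (n : nat) (alpha : 'M[R]_(n.+2)) (alpha0 : 'M[R]_2)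
    (x : 'rV[R]_3) : 'rV[R]_3 :=
  psi1_comb alpha x - (alpha 0 0 / face1_area) *: @psi1_comb 0 alpha0 x.

End Hexahedra.

Arguments face1_expansion {R} H a b l m alpha.

(* Main.v *)
Require Import Defs.
From HB Require Import structures.
From mathcomp Require Import all_boot all_order all_algebra.
From mathcomp Require Import all_classical all_reals all_analysis.
From mathcomp Require mpoly.
From mathcomp Require Import ring lra.
Import (canonicals) mpoly.
Set Implicit Arguments.
Unset Strict Implicit.
Unset Printing Implicit Defensive.
Import Order.TTheory GRing.Theory Num.Theory.
Import numFieldNormedType.Exports.
Local Open Scope classical_set_scope.
Local Open Scope ring_scope.

(** Let F be the trilinear map of the reference cube onto the hexahedron E.
    The statement reduces to polynomial algebra on the cube because F is a
    bijection onto E with differentiable inverse, and because its Piola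
    transform divides divergences by J and normal components by a polynomial
    attached to the face.

    Faces.  Let the face i of E correspond to x_k = e.  The slack
    h_i - nu_i . F of its inequality is trilinear and vanishes for x_k = e, so
    it is the distance from x_k to e times a factor independent of x_k
    (slack_mapE).  This factor is positive on the cube, because opposite faces
    of E are disjoint (opposite_faces_disjoint).  Hence F x lies on the face i
    only if x_k = e.  There the derivatives of F along the two other axes are
    tangent to the face, while the sign of nu_i . d_k F is known.

    Bijectivity.  Let z be a point of E and let x minimise |F x - z|^2 on the
    intersection of the cube with a ball, x not on the sphere.  Write
    z - F x = sum_k c_k d_k F(x).  The inequalities of E at z say that the
    vector c points into the cube at x; hence minimality gives
    c_k (F x - z) . d_k F(x) >= 0 for each k, and the sum of these
    inequalities is |F x - z|^2 <= 0 (dist_min_hits).  With a large ball this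
    is surjectivity; with small balls it says that F is open onto E
    (hex_map_open).  For injectivity, F y - F x = (y - x) M(x, y) for a
    continuous matrix M with det M(x, x) = J(x) > 0, so the pairs x <> y of the
    cube with F x = F y form a compact set.  If there were such a pair, take one
    with F x as close as possible to a vertex, in the sense of the sum of three
    slacks; by openness both x and y can be moved so that their common image
    goes towards this vertex, which is absurd (hex_map_inj).  The matrix M also
    gives the derivative of the inverse (has_grad_hex_ref_point).

    Piola transform.  The divergence is divided by J (has_div_piola).  On the
    face i, the cross product of the two tangent derivatives of F is
    kappa_i nu_i, where kappa_i (face_flux) has degree at most 1 in each
    variable, and J = (nu_i . d_k F) kappa_i; so the normal component of the
    transform of v is v_k / kappa_i (piola_flux).

    Construction.  One needs a polynomial field v of divergence 0 with
    v_k = kappa_i (x_a^l x_b^m - c) on one face of the cube and no normal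
    component on the others.  The fields psi_pq (shape) have no normal
    component on the other faces, their divergence is 0 except that psi_00 has
    divergence 1, and on their face v_k runs through a basis of the polynomials
    in two variables.  Expanding kappa_i x_a^l x_b^m and kappa_i in this basis
    gives two fields of constant divergence, and c is the ratio of the two
    constants.  Up to the sign of kappa_i, the second constant is the value of
    kappa_i at the centre of the face, thus nonzero, and also the integral of
    kappa_i, that is, the area of the face (face1_areaE). *)

(** * Coordinates of R^3 *)

Lemma ord3_ind (P : 'I_3 -> Prop) : P 0 -> P 1 -> P 2 -> forall k, P k.
Proof.
move=> P0 P1 P2 [[|[|[|//]]] lt3].
- by rewrite (_ : Ordinal lt3 = 0)//; apply: val_inj.
- by rewrite (_ : Ordinal lt3 = 1)//; apply: val_inj.
- by rewrite (_ : Ordinal lt3 = 2)//; apply: val_inj.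
Qed.

Lemma sum_ord3 (V : nmodType) (f : 'I_3 -> V) : \sum_j f j = f 0 + f 1 + f 2.
Proof.
rewrite !big_ord_recl big_ord0 addr0 addrA; congr (_ + f _ + f _).
- exact: val_inj.
- exact: val_inj.
Qed.

Section Vec.
Context {R : realType}.
Implicit Types u v : 'rV[R]_3.

Lemma row3P u v : u 0 0 = v 0 0 -> u 0 1 = v 0 1 -> u 0 2 = v 0 2 -> u = v.
Proof. by move=> u0 u1 u2; apply/rowP; elim/ord3_ind. Qed.

Lemma dotE u v : dot u v = u 0 0 * v 0 0 + u 0 1 * v 0 1 + u 0 2 * v 0 2.
Proof. exact: sum_ord3. Qed.

Lemma cvg_rV (T : Type) (F : set_system T) (FF : Filter F) (n : nat) (f : T -> 'rV[R]_n)
    (a : 'rV[R]_n) :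
  (forall j, f x 0 j @[x --> F] --> a 0 j) -> f x @[x --> F] --> a.
Proof.
move=> fa; apply/cvgrPdist_lt => e e0.
have : \forall x \near F, forall j, `|a 0 j - f x 0 j| < e.
  apply: filter_forall => j; have /cvgrPdist_lt := fa j; exact.
apply: filterS => x xe.
rewrite /Num.norm/= mx_normrE; apply/bigmax_ltP; split => // -[i j] _ /=.
by rewrite ord1 !mxE.
Qed.

Lemma cvg_sum_ord3 (T : Type) (F : set_system T) (FF : Filter F)
    (f : 'I_3 -> T -> R) (l : 'I_3 -> R) :
  (forall k, f k y @[y --> F] --> l k) ->
  \sum_k f k y @[y --> F] --> \sum_k l k.
Proof.
move=> fl; rewrite sum_ord3; under eq_fun do rewrite sum_ord3.
by apply: cvgD; [apply: cvgD|].
Qed.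

Lemma coord_le_norm u j : `|u 0 j| <= `|u|.
Proof.
rewrite [leRHS]/Num.norm/= mx_normrE; apply/bigmax_geP; right.
by exists (0, j).
Qed.

End Vec.

(** * Differentiation through secant coefficients *)

Section Gradients.
Context {R : realType}.
Implicit Types (x y : 'rV[R]_3) (u w : 'rV[R]_3 -> R) (a b : 'I_3 -> R).

(** Caratheodory's form of differentiability.  The sum, product and chain rules
    become identities between secant coefficients, and the inverse of a map
    whose secant matrix is known can be differentiated at once. *)
Definition has_grad u x a : Prop := exists2 phi : 'I_3 -> 'rV[R]_3 -> R,
  (forall k, phi k y @[y --> x] --> a k) &
  \forall y \near x, u y = u x + \sum_k (y 0 k - x 0 k) * phi k y.

Lemma eq_has_grad u w x a b :
  u =1 w -> a =1 b -> has_grad w x b -> has_grad u x a.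
Proof. by move=> /funext-> /funext->. Qed.

Lemma coord_cvg x j : y 0 j @[y --> x] --> x 0 j.
Proof. exact: coord_continuous. Qed.

Lemma cst_cvg (c : R) x : (fun=> c) y @[y --> x] --> c.
Proof. exact: (@cvg_cst _ _ _ (nbhs x)). Qed.

Lemma has_grad_continuous u x a : has_grad u x a -> u y @[y --> x] --> u x.
Proof.
move=> [phi phia uE].
pose v := fun y : 'rV[R]_3 => u x + \sum_k (y 0 k - x 0 k) * phi k y.
have uE' : \forall y \near x, v y = u y by apply: filterS uE => y ->.
apply: cvg_trans (near_eq_cvg uE') _.
have -> : u x = u x + \sum_(k < 3) (x 0 k - x 0 k) * a k.
  by rewrite big1 ?addr0// => k _; rewrite subrr mul0r.
apply: cvgD; first exact: cvg_cst.
apply: cvg_sum_ord3 => k; apply: cvgM; last exact: phia.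
by apply: cvgB; [exact: coord_cvg|exact: cvg_cst].
Qed.

Lemma has_grad_cst c x : has_grad (fun=> c) x (fun=> 0).
Proof.
exists (fun _ _ => 0) => [k /=|]; first exact: cst_cvg.
by apply: (@nearW _ (nbhs x)) => y; rewrite big1 ?addr0// => k _; rewrite mulr0.
Qed.

Lemma has_grad_coord j x : has_grad (fun y => y 0 j) x (fun k => (k == j)%:R).
Proof.
exists (fun k _ => (k == j)%:R) => [k /=|]; first exact: cst_cvg.
apply: (@nearW _ (nbhs x)) => y; rewrite (bigD1 j)//= big1 => [|k kj]; last first.
  by rewrite (negbTE kj) mulr0.
by rewrite eqxx mulr1 addr0 addrC subrK.
Qed.

Lemma has_gradD u w x a b : has_grad u x a -> has_grad w x b ->
  has_grad (fun y => u y + w y) x (fun k => a k + b k).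
Proof.
move=> [f fa uE] [g gb wE]; exists (fun k y => f k y + g k y) => [k /=|].
  by apply: (@cvgD _ _ _ (nbhs x)).
apply: filterS2 uE wE => y -> ->; rewrite !sum_ord3; ring.
Qed.

Lemma has_gradM u w x a b : has_grad u x a -> has_grad w x b ->
  has_grad (fun y => u y * w y) x (fun k => u x * b k + a k * w x).
Proof.
move=> uxa wxb; have uc := has_grad_continuous uxa.
have [f fa uE] := uxa; have [g gb wE] := wxb.
exists (fun k y => u y * g k y + f k y * w x) => [k /=|].
  by apply: (@cvgD _ _ _ (nbhs x)); apply: (@cvgM _ _ (nbhs x)) => //; exact: cst_cvg.
apply: filterS2 uE wE => y -> ->; rewrite !sum_ord3; ring.
Qed.

Lemma has_gradV u x a : u x != 0 -> has_grad u x a ->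
  has_grad (fun y => (u y)^-1) x (fun k => - a k * (u x)^-1 * (u x)^-1).
Proof.
move=> ux0 uxa; have uc := has_grad_continuous uxa.
have [f fa uE] := uxa.
exists (fun k y => - f k y * (u y)^-1 * (u x)^-1) => [k /=|].
  apply: (@cvgM _ _ (nbhs x)); last exact: cst_cvg.
  by apply: (@cvgM _ _ (nbhs x)); [apply: (@cvgN _ _ _ (nbhs x))|apply: (@cvgV _ _ (nbhs x))].
have un0 : \forall y \near x, u y != 0.
  have /cvgr_neq0 := uc; exact.
apply: filterS2 un0 uE => y un0 uyE.
rewrite sum_ord3 in uyE; rewrite sum_ord3.
have e : (u y)^-1 = (u x)^-1 - (u y - u x) * (u y)^-1 * (u x)^-1 by field; rewrite ?un0 ?ux0.
rewrite {1}e {1}uyE; ring.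
Qed.

Lemma has_grad_sum (I : Type) (r : seq I) (P : pred I) (u : I -> 'rV[R]_3 -> R) x
    (a : I -> 'I_3 -> R) : (forall i, P i -> has_grad (u i) x (a i)) ->
  has_grad (fun y => \sum_(i <- r | P i) u i y) x
           (fun k => \sum_(i <- r | P i) a i k).
Proof.
move=> H; elim: r => [|i r IH].
  by apply: eq_has_grad (has_grad_cst 0 x) => ?; rewrite big_nil.
have [Pi|nPi] := boolP (P i).
  by apply: eq_has_grad (has_gradD (H i Pi) IH) => ?; rewrite big_cons Pi.
by apply: eq_has_grad IH => ?; rewrite big_cons (negbTE nPi).
Qed.

Lemma has_gradX u x a n : has_grad u x a ->
  has_grad (fun y => u y ^+ n) x (fun k => n%:R * u x ^+ n.-1 * a k).
Proof.
move=> ua; elim: n => [|n IH].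
  by apply: eq_has_grad (has_grad_cst 1 x) => k; rewrite ?mul0r ?expr0.
apply: eq_has_grad (has_gradM ua IH) => k; first by rewrite exprS.
case: n {IH} => [|n] /=; first by rewrite !expr0; ring.
rewrite exprS -(natr1 n.+1); ring.
Qed.

Lemma has_grad_comp u (g : 'rV[R]_3 -> 'rV[R]_3) x a (b : 'I_3 -> 'I_3 -> R) :
  (forall j, has_grad (fun y => g y 0 j) x (b j)) -> has_grad u (g x) a ->
  has_grad (u \o g) x (fun k => \sum_j a j * b j k).
Proof.
move=> gb [phi phia uE].
have gc : g y @[y --> x] --> g x.
  by apply: (@cvg_rV _ _ (nbhs x)) => j; apply: has_grad_continuous (gb j).
have /choice[f fP] : forall j, exists f : 'I_3 -> 'rV[R]_3 -> R,
    (forall k, f k y @[y --> x] --> b j k) /\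
    \forall y \near x, g y 0 j = g x 0 j + \sum_k (y 0 k - x 0 k) * f k y.
  by move=> j; have [f ? ?] := gb j; exists f.
exists (fun k y => \sum_j phi j (g y) * f j k y) => [k /=|].
  apply: (@cvg_sum_ord3 _ _ (nbhs x)) => j; apply: (@cvgM _ _ (nbhs x)); last exact: (fP j).1.
  by apply: (cvg_comp _ _ gc (phia j)).
have gE : \forall y \near x, forall j,
    g y 0 j = g x 0 j + \sum_k (y 0 k - x 0 k) * f j k y.
  by apply: (@filter_forall _ _ _ (nbhs x)) => j; exact: (fP j).2.
have uE' := gc _ uE.
apply: filterS2 gE uE' => y gE /= ->; congr (_ + _).
rewrite sum_ord3 !gE !sum_ord3; ring.
Qed.

(** The error term is a combination of the increments of the coordinates with
    coefficients phi_k - a_k, which tend to 0. *)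
Lemma has_grad_diff u x a : has_grad u x a ->
  is_diff x u (fun v => \sum_k v 0 k * a k).
Proof.
move=> [phi phia uE].
pose l (v : 'rV[R]_3) : R := \sum_k v 0 k * a k.
have llin : linear l.
  by move=> c v w; rewrite /l !sum_ord3 !mxE /GRing.scale/=; ring.
pose lM := GRing.isLinear.Build _ _ _ _ l llin.
pose L : {linear 'rV[R]_3 -> R} := HB.pack l lM.
have Lc : continuous L.
  move=> v; apply: (@cvg_sum_ord3 _ _ (nbhs v)) => k.
  by apply: (@cvgM _ _ (nbhs v)); [exact: coord_cvg|exact: cst_cvg].
pose W : normedModType R := R.
suff H : (u : _ -> W) \o shift x = cst (u x : W) + (L : _ -> W) +o_ (0 : 'rV[R]_3) id.
  have dE := @diff_unique R 'rV[R]_3 W u L x Lc H.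
  apply: DiffDef; last by rewrite dE.
  by apply/diff_locallyP; rewrite dE.
apply/eqaddoP => _/posnumP[e].
have uE0 : \forall v \near (0 : 'rV[R]_3),
    u (v + x) = u x + \sum_k (v 0 k) * phi k (v + x).
  have := uE; rewrite (near_shift 0 x) subr0; apply: filterS => v /= ->.
  by congr (_ + _); apply: eq_bigr => k _; rewrite mxE addrK.
have phi0 : \forall v \near (0 : 'rV[R]_3), forall k, `|a k - phi k (v + x)| < e%:num / 3.
  have : \forall v \near x, forall k, `|a k - phi k v| < e%:num / 3.
    apply: (@filter_forall _ _ _ (nbhs x)) => k; have /cvgrPdist_lt := phia k; apply.
    by rewrite divr_gt0.
  by rewrite (near_shift 0 x) subr0; apply: filterS => v.
apply: filterS2 uE0 phi0 => v /= uvE pv.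
rewrite !fctE /= uvE /L /= /l.
rewrite (_ : _ - _ = \sum_k v 0 k * (phi k (v + x) - a k)); last by rewrite !sum_ord3; ring.
apply: le_trans (ler_norm_sum _ _ _) _.
apply: (@le_trans _ _ (\sum_(k < 3) `|v| * (e%:num / 3))).
  apply: ler_sum => k _; rewrite normrM; apply: ler_pM => //; first exact: coord_le_norm.
  by rewrite distrC ltW.
rewrite sumr_const card_ord -mulr_natr.
by rewrite le_eqVlt; apply/orP; left; apply/eqP; field.
Qed.

Lemma has_grad_diff_rV (f : 'rV[R]_3 -> 'rV[R]_3) x (a : 'I_3 -> 'I_3 -> R) :
  (forall j, has_grad (fun y => f y 0 j) x (a j)) ->
  differentiable f x /\ forall v, 'd f x v = \row_j \sum_k v 0 k * a j k.
Proof.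
move=> fa.
have fE : f = \sum_j (fun y => f y 0 j *: (delta_mx 0 j : 'rV[R]_3)).
  by apply/funext => y; rewrite fct_sumE; exact: row_sum_delta.
have df j : is_diff x (fun y => f y 0 j *: (delta_mx 0 j : 'rV[R]_3))
    (fun v => (\sum_k v 0 k * a j k) *: (delta_mx 0 j : 'rV[R]_3)).
  have H := has_grad_diff (fa j); have dj : differentiable (fun y => f y 0 j) x by [].
  apply: DiffDef; first exact: differentiableZl.
  rewrite (diffZl (delta_mx 0 j : 'rV[R]_3) dj); apply/funext => v /=.
  by rewrite diff_val.
have dfx : is_diff x f (\sum_j (fun v => (\sum_k v 0 k * a j k) *: (delta_mx 0 j : 'rV[R]_3))).
  rewrite [X in is_diff _ X]fE !sum_ord3.
  exact: is_diffD (is_diffD (df 0) (df 1)) (df 2).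
split => // v; rewrite diff_val fct_sumE; apply/rowP => j; rewrite summxE [RHS]mxE.
rewrite (bigD1 j)//= [X in _ + X]big1 ?addr0 => [|i ij].
  by rewrite !mxE !eqxx mulr1.
by rewrite !mxE (eq_sym j) (negbTE ij) andbF mulr0.
Qed.

Lemma has_grad_jacobian (f : 'rV[R]_3 -> 'rV[R]_3) x (a : 'I_3 -> 'I_3 -> R) :
  (forall j, has_grad (fun y => f y 0 j) x (a j)) ->
  jacobian f x = \matrix_(k, j) a j k.
Proof.
move=> /has_grad_diff_rV[_ dE]; apply/matrixP => k j.
rewrite /jacobian !mxE /= dE mxE (bigD1 k)//= big1 ?addr0 => [|i ik].
  by rewrite mxE !eqxx mul1r.
by rewrite mxE (negbTE ik) andbF mul0r.
Qed.

Lemma has_grad_derive (f : 'rV[R]_3 -> 'rV[R]_3) x (a : 'I_3 -> 'I_3 -> R) k :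
  (forall j, has_grad (fun y => f y 0 j) x (a j)) ->
  'D_(basis_vec k) f x = \row_j a j k.
Proof.
move=> fa; have [df _] := has_grad_diff_rV fa.
rewrite deriveEjacobian// (has_grad_jacobian fa) -rowE.
by apply/rowP => j; rewrite !mxE.
Qed.

End Gradients.

Section Divergence.
Context {R : realType}.
Implicit Types (v w : 'rV[R]_3 -> 'rV[R]_3) (x : 'rV[R]_3) (d : R).

(** The partial derivatives off the diagonal are only required to exist. *)
Definition has_div v x d : Prop := exists2 g : 'I_3 -> 'I_3 -> R,
  forall j, has_grad (fun y => v y 0 j) x (g j) & \sum_j g j j = d.

Lemma has_div_divergence v x d :
  has_div v x d -> differentiable v x /\ divergence v x = d.
Proof.
move=> [g vg <-]; split; first by have [] := has_grad_diff_rV vg.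
by apply: eq_bigr => j _; rewrite (has_grad_derive j vg) mxE.
Qed.

Lemma has_divD v w x d d' : has_div v x d -> has_div w x d' ->
  has_div (fun y => v y + w y) x (d + d').
Proof.
move=> [g vg <-] [h wh <-]; exists (fun j k => g j k + h j k) => [j|].
  by apply: eq_has_grad (has_gradD (vg j) (wh j)) => y //; rewrite mxE.
exact: big_split.
Qed.

Lemma has_divZ v x c d : has_div v x d -> has_div (fun y => c *: v y) x (c * d).
Proof.
move=> [g vg <-]; exists (fun j k => c * g j k) => [j|]; last by rewrite mulr_sumr.
apply: eq_has_grad (has_gradM (has_grad_cst c x) (vg j)) => y; first by rewrite mxE.
by rewrite mul0r addr0.
Qed.

Lemma has_div_sum (I : Type) (r : seq I) (v : I -> 'rV[R]_3 -> 'rV[R]_3) x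
    (d : I -> R) : (forall i, has_div (v i) x (d i)) ->
  has_div (fun y => \sum_(i <- r) v i y) x (\sum_(i <- r) d i).
Proof.
move=> vd; elim: r => [|i r IH].
  rewrite big_nil; exists (fun _ _ => 0) => [j|]; last by rewrite big1.
  by apply: eq_has_grad (has_grad_cst 0 x) => y //; rewrite big_nil mxE.
rewrite big_cons; have [g vg gd] := has_divD (vd i) IH; exists g => // j.
by apply: eq_has_grad (vg j) => y //; rewrite big_cons.
Qed.

End Divergence.

(** * Trilinear interpolation of vertex values *)

Section Trilinear.
Context {R : realType}.
Implicit Types (c : bool -> bool -> bool -> R) (x y : 'rV[R]_3).

Definition tri c x : R := \sum_(i : bool) \sum_(j : bool) \sum_(k : bool)
  lin_weight i (x 0 0) * lin_weight j (x 0 1) * lin_weight k (x 0 2) * c i j k.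

Definition set_coord x (k : 'I_3) (t : R) : 'rV[R]_3 :=
  \row_j if j == k then t else x 0 j.

(** As tri c has degree at most 1 in x_k, this difference is the k-th partial
    derivative. *)
Definition dtri c k x : R := tri c (set_coord x k 1) - tri c (set_coord x k 0).

(** The path from x to y changes the coordinates one at a time, the last one
    first; the step along the axis k takes place at the other coordinates of
    mix k x y. *)
Definition mix (k : 'I_3) x y : 'rV[R]_3 :=
  \row_j if (j < k)%N then x 0 j else y 0 j.

(** Which of the two faces orthogonal to the axis k contains the vertex ijl. *)
Definition corner_bit (k : 'I_3) (i j l : bool) : bool :=
  if k == 0 then i else if k == 1 then j else l.

(** Nested convex combinations: positivity and continuity are inherited level by
    level. *)
Lemma triE c x : tri c x =
  (1 - x 0 0) * ((1 - x 0 1) * ((1 - x 0 2) * c false false false + x 0 2 * c false false true)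
                 + x 0 1 * ((1 - x 0 2) * c false true false + x 0 2 * c false true true)) +
  x 0 0 * ((1 - x 0 1) * ((1 - x 0 2) * c true false false + x 0 2 * c true false true)
                 + x 0 1 * ((1 - x 0 2) * c true true false + x 0 2 * c true true true)).
Proof. by rewrite /tri !big_bool /lin_weight /=; ring. Qed.

Lemma set_coordE x k t j : set_coord x k t 0 j = if j == k then t else x 0 j.
Proof. by rewrite mxE. Qed.

Lemma set_coord_id x k : set_coord x k (x 0 k) = x.
Proof. by apply/rowP => j; rewrite mxE; case: eqP => // ->. Qed.

Lemma tri_set_coord c k x t :
  tri c (set_coord x k t) = tri c (set_coord x k 0) + t * dtri c k x.
Proof. by rewrite /dtri !triE !set_coordE; elim/ord3_ind: k => /=; ring. Qed.

Lemma tri_affine c k x t :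
  tri c (set_coord x k t) = tri c x + (t - x 0 k) * dtri c k x.
Proof.
have xE := tri_set_coord c k x (x 0 k); rewrite set_coord_id in xE.
by rewrite tri_set_coord xE; ring.
Qed.

Lemma tri_telescope c x y :
  tri c y = tri c x + \sum_k (y 0 k - x 0 k) * dtri c k (mix k x y).
Proof.
rewrite sum_ord3 /dtri !triE !set_coordE /mix !mxE /=; ring.
Qed.

Lemma lerp_cvg (T : Type) (F : set_system T) (FF : Filter F) (u a b : T -> R)
    (u' a' b' : R) :
  u t @[t --> F] --> u' -> a t @[t --> F] --> a' -> b t @[t --> F] --> b' ->
  (1 - u t) * a t + u t * b t @[t --> F] --> (1 - u') * a' + u' * b'.
Proof.
move=> uu aa bb; apply: cvgD; apply: cvgM => //.
by apply: cvgB => //; exact: cvg_cst.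
Qed.

Lemma tri_cvg c (T : Type) (F : set_system T) (FF : Filter F)
    (g : T -> 'rV[R]_3) y :
  (forall j, g t 0 j @[t --> F] --> y 0 j) -> tri c (g t) @[t --> F] --> tri c y.
Proof.
move=> gy; under eq_fun do rewrite triE; rewrite triE.
by do 3 (apply: lerp_cvg; [exact: gy| |]); exact: cvg_cst.
Qed.

Lemma dtri_cvg c k (T : Type) (F : set_system T) (FF : Filter F)
    (g : T -> 'rV[R]_3) y :
  (forall j, g t 0 j @[t --> F] --> y 0 j) ->
  dtri c k (g t) @[t --> F] --> dtri c k y.
Proof.
move=> gy; apply: cvgB; apply: tri_cvg => j; rewrite set_coordE;
  under eq_fun do rewrite set_coordE; case: eqP => _; first [exact: gy|exact: cvg_cst].
Qed.

Lemma mix_cvg (T : Type) (F : set_system T) (FF : Filter F)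
    (g h : T -> 'rV[R]_3) x y k :
  (forall j, g t 0 j @[t --> F] --> x 0 j) ->
  (forall j, h t 0 j @[t --> F] --> y 0 j) ->
  forall j, mix k (g t) (h t) 0 j @[t --> F] --> mix k x y 0 j.
Proof.
move=> gx hy j; rewrite mxE; under eq_fun do rewrite mxE.
by case: ifP => _; [exact: gx|exact: hy].
Qed.

Lemma mix_id k x : mix k x x = x.
Proof. by apply/rowP => j; rewrite mxE if_same. Qed.

Lemma has_grad_tri c x : has_grad (tri c) x (fun k => dtri c k x).
Proof.
exists (fun k y => dtri c k (mix k x y)) => [k|].
  have mixx j : mix k x y 0 j @[y --> x] --> x 0 j.
    have := @mix_cvg _ (nbhs x) _ (fun=> x) id x x k.
    rewrite mix_id; apply => i; [exact: cst_cvg|exact: coord_cvg].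
  exact: (@dtri_cvg _ _ _ (nbhs x)).
by apply: (@nearW _ (nbhs x)) => y; exact: tri_telescope.
Qed.

(** The second partial derivatives, again as differences. *)
Definition ddtri c k x (m : 'I_3) : R :=
  if m == k then 0 else dtri c m (set_coord x k 1) - dtri c m (set_coord x k 0).

Lemma has_grad_dtri c k x : has_grad (dtri c k) x (ddtri c k x).
Proof.
pose b (j m : 'I_3) : R := (j != k)%:R * (m == j)%:R.
have sg (t : R) j : has_grad (fun y => set_coord y k t 0 j) x (b j).
  rewrite /b; under eq_fun do rewrite set_coordE.
  case: (j == k).
    apply: eq_has_grad (has_grad_cst t x) => // m; by rewrite mul0r.
  by apply: eq_has_grad (has_grad_coord j x) => // m; rewrite mul1r.
have d t := has_grad_comp (sg t) (has_grad_tri c (set_coord x k t)).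
have d0 := has_gradM (has_grad_cst (-1) x) (d 0).
apply: eq_has_grad (has_gradD (d 1) d0) => [y|m]; first by rewrite mulN1r.
rewrite /ddtri mul0r addr0 mulN1r !sum_ord3 /b.
by elim/ord3_ind: k {sg d d0 b}; elim/ord3_ind: m => /=; ring.
Qed.

Lemma ddtri_sym c k m x : ddtri c k x m = ddtri c m x k.
Proof.
rewrite /ddtri (eq_sym k); case: eqP => // mk.
have set_swap s t : set_coord (set_coord x k s) m t = set_coord (set_coord x m t) k s.
  apply/rowP => j; rewrite !mxE; case: eqP => // ->.
  by case: eqP.
by rewrite /dtri !set_swap; ring.
Qed.

Lemma lin_weight_ge0 e (t : R) : 0 <= t <= 1 -> 0 <= lin_weight e t.
Proof. by case: e; rewrite /lin_weight; lra. Qed.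

Lemma tri_ge0 c x : ref_cube x -> (forall i j k, 0 <= c i j k) -> 0 <= tri c x.
Proof.
move=> xcube c0; apply: sumr_ge0 => i _; apply: sumr_ge0 => j _.
apply: sumr_ge0 => k _; rewrite !mulr_ge0 ?lin_weight_ge0//; exact: xcube.
Qed.

Lemma convex_comb_gt0 (a b t : R) : 0 <= t <= 1 -> 0 < a -> 0 < b ->
  0 < (1 - t) * a + t * b.
Proof.
move=> /andP[t0 t1] a0 b0; have [->|tn0] := eqVneq t 0.
  by rewrite subr0 mul1r mul0r addr0.
apply: ltr_wpDl; first by rewrite mulr_ge0 ?subr_ge0// ltW.
by rewrite mulr_gt0// lt0r tn0.
Qed.

Lemma tri_side_gt0 c k (e : bool) x : ref_cube x ->
  (forall i j l, corner_bit k i j l = e -> 0 < c i j l) ->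
  0 < tri c (set_coord x k e%:R).
Proof.
move=> xcube; rewrite triE !set_coordE; have x0 := xcube 0.
have x1 := xcube 1; have x2 := xcube 2.
elim/ord3_ind: k => /= cgt0; case: e cgt0 => /= cgt0;
  rewrite ?(subr0, subrr, mul0r, mul1r, addr0, add0r);
  by do ![apply: convex_comb_gt0 => //]; apply: cgt0.
Qed.

Lemma tri_side_eq0 c k (e : bool) x :
  (forall i j l, corner_bit k i j l = e -> c i j l = 0) ->
  tri c (set_coord x k e%:R) = 0.
Proof.
rewrite triE !set_coordE.
elim/ord3_ind: k => /= c0; case: e c0 => /= c0;
  rewrite ?(subr0, subrr, mul0r, mul1r, addr0, add0r) !c0//; ring.
Qed.

Lemma triB_dot (h : R) (n : 'rV[R]_3) (V : bool -> bool -> bool -> 'rV[R]_3) x :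
  tri (fun i j k => h - dot n (V i j k)) x =
  h - (n 0 0 * tri (fun i j k => V i j k 0 0) x +
       n 0 1 * tri (fun i j k => V i j k 0 1) x +
       n 0 2 * tri (fun i j k => V i j k 0 2) x).
Proof. by rewrite !triE !dotE; ring. Qed.

End Trilinear.

(** * Faces of the hexahedron *)

Definition face_index (k : 'I_3) (e : bool) : 'I_6 := inord (k.*2 + e).

Lemma face_index_val k e : face_index k e = (k.*2 + e)%N :> nat.
Proof. by rewrite inordK//; elim/ord3_ind: k; case: e. Qed.

Lemma face_indexP (i : 'I_6) : exists k e, i = face_index k e.
Proof.
exists (inord i./2), (odd i); apply: val_inj => /=.
rewrite face_index_val inordK; first by rewrite addnC odd_double_half.
by rewrite ltn_half_double.
Qed.

Definition side_sign {R : realType} (e : bool) : R := if e then 1 else -1.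

Lemma side_signK {R : realType} e : side_sign e * side_sign e = 1 :> R.
Proof. by case: e; rewrite /side_sign ?mulrNN mulr1. Qed.

Section Geometry.
Context {R : realType}.
Implicit Types (x y z u v : 'rV[R]_3) (k : 'I_3) (e : bool).

Definition sqn u : R := dot u u.

Lemma sqn_ge0 u : 0 <= sqn u.
Proof. by rewrite /sqn dotE -!expr2 !addr_ge0// sqr_ge0. Qed.

Lemma sqn_eq0 u : sqn u <= 0 -> u = 0.
Proof.
rewrite /sqn dotE -!expr2 => H; have := sqr_ge0 (u 0 0); have := sqr_ge0 (u 0 1).
have := sqr_ge0 (u 0 2) => H2 H1 H0.
by apply: row3P; rewrite mxE; apply/eqP; rewrite -sqrf_eq0; apply/eqP; lra.
Qed.

Lemma dot_lin u (c : 'rV[R]_3) (w : 'I_3 -> 'rV[R]_3) :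
  dot u (\sum_k c 0 k *: w k) = \sum_k c 0 k * dot u (w k).
Proof. by rewrite !sum_ord3 !dotE !mxE; ring. Qed.

Lemma ref_faceE k e x : ref_face (face_index k e) x <-> ref_cube x /\ x 0 k = e%:R.
Proof.
rewrite /ref_face /= face_index_val addnC half_bit_double oddD odd_double addbF oddb.
by rewrite inord_val.
Qed.

(** First order condition at a one-sided minimum of a quadratic polynomial. *)
Lemma one_sided_min (p q d : R) : 0 < d ->
  (forall t, 0 < t <= d -> 0 <= t * p *+ 2 + t ^+ 2 * q) -> 0 <= p.
Proof.
move=> d0 H; rewrite leNgt; apply/negP => p0.
have Q : 0 < `|q| + 1 by rewrite ltr_wpDl.
pose t := Num.min d (- p / (`|q| + 1)).
have t0 : 0 < t by rewrite lt_min d0 divr_gt0// oppr_gt0.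
have td : t <= d by rewrite ge_min lexx.
have tq : t * (`|q| + 1) <= - p by rewrite -ler_pdivlMr// ge_min lexx orbT.
have /H : 0 < t <= d by rewrite t0.
have -> : t * p *+ 2 + t ^+ 2 * q = t * (p *+ 2 + t * q) by ring.
rewrite pmulr_rge0//; have tqq : t * q <= t * `|q| by rewrite ler_pM2l// ler_norm.
by nra.
Qed.

Lemma norm_set_coord x k t : `|set_coord x k t - x| <= `|t - x 0 k|.
Proof.
rewrite [leLHS]/Num.norm/= mx_normrE; apply/bigmax_leP; split => // -[i j] _ /=.
rewrite ord1 !mxE; case: eqP => [->//|_].
by rewrite subrr normr0.
Qed.

Variable H : hexahedron R.

Let V := hex_vertex H.
Let E := hex_set H.

Lemma hex_vertex_face k i j l :
  hex_face H (face_index k (corner_bit k i j l)) (V i j l).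
Proof.
have : [set hex_vertex H i j l] (V i j l) by [].
rewrite -hex_vertexE => -[[H0 H1] H2].
by elim/ord3_ind: k.
Qed.

Lemma vertex_in_hex i j l : E (V i j l).
Proof. by have [] := hex_vertex_face 0 i j l. Qed.

Lemma common_face_point x i j l : (forall f, hex_face H f x) -> x = V i j l.
Proof.
move=> xf; suff : [set hex_vertex H i j l] x by [].
by rewrite -hex_vertexE; split; first split; apply: xf.
Qed.

(** In the cube, opposite faces do not meet, so their intersection is contained
    in that of all six faces; by the combinatorial equivalence the same holds in
    E.  But a point common to the six faces would be every vertex at once, so
    that the intersections of the faces 0, 2, 4 and of the faces 1, 3, 5 would
    coincide in E, which they do not in the cube. *)
Lemma opposite_faces_disjoint k x :
  hex_face H (face_index k false) x -> hex_face H (face_index k true) x -> False.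
Proof.
move=> xf0 xf1.
have xall : forall f, hex_face H f x.
  have /hex_combinatorial_cube : face_meet (@ref_cube R) (@ref_face R)
      [set face_index k false; face_index k true] `<=`
      face_meet (@ref_cube R) (@ref_face R) [set: 'I_6].
    move=> y [_ yf]; have /ref_faceE[_ y0] := yf _ (set21 _ _).
    have /ref_faceE[_] := yf _ (set22 _ _); rewrite y0 => /eqP.
    by rewrite eq_sym oner_eq0.
  move=> /(_ H x)[]; first by split; [case: xf0|move=> i /set2P[]->].
  by move=> _ xf f; apply: xf; rewrite inE.
have V01 : V false false false = V true true true.
  by rewrite -(common_face_point false false false xall); exact: common_face_point.
have /hex_combinatorial_cube : face_meet (polyhedron (hex_normal H) (hex_offset H))
    (polyhedron_face (hex_normal H) (hex_offset H))
    [set face_index k false | k : 'I_3] `<=`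
    face_meet (polyhedron (hex_normal H) (hex_offset H))
    (polyhedron_face (hex_normal H) (hex_offset H)) [set face_index k true | k : 'I_3].
  move=> y [yE yf]; have -> : y = V true true true.
    rewrite -V01; suff : [set hex_vertex H false false false] y by [].
    have fy j : hex_face H (face_index j false) y by apply: yf; apply: imset_f.
    by rewrite -hex_vertexE; split; first split; [exact: (fy 0)|exact: (fy 1)|exact: (fy 2)].
  split; first exact: vertex_in_hex.
  move=> _ /imsetP[j _ ->]; have := hex_vertex_face j true true true.
  by rewrite /corner_bit !if_same.
have cube0 : ref_cube (0 : 'rV[R]_3) by move=> j; rewrite mxE lexx ler01.
move=> /(_ 0)[].
  by split => // _ /imsetP[j _ ->]; apply/ref_faceE; rewrite mxE.
move=> _ /(_ (face_index 0 true))/(_ (imset_f _ isT)) /ref_faceE[_].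
by rewrite mxE => /eqP; rewrite eq_sym oner_eq0.
Qed.

(** The amount by which z satisfies the inequality of the face f. *)
Definition slack (f : 'I_6) z : R := hex_offset H f - dot (hex_normal H f) z.

Lemma slack_ge0 f z : E z -> 0 <= slack f z.
Proof. by rewrite subr_ge0; apply. Qed.

Lemma slack_eq0 f z : hex_face H f z -> slack f z = 0.
Proof. by move=> [_]; rewrite /slack => ->; rewrite subrr. Qed.

Lemma slack_vertex_gt0 k e i j l :
  corner_bit k i j l = ~~ e -> 0 < slack (face_index k e) (V i j l).
Proof.
move=> ke; rewrite lt0r slack_ge0 ?andbT; last exact: vertex_in_hex.
apply/eqP => s0.
have f1 := hex_vertex_face k i j l; rewrite ke in f1.
have f2 : hex_face H (face_index k e) (V i j l).
  by split; [exact: vertex_in_hex|apply/eqP; rewrite eq_sym -subr_eq0; apply/eqP].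
case: e {ke s0} f1 f2 => /= f1 f2; first exact: opposite_faces_disjoint f1 f2.
exact: opposite_faces_disjoint f2 f1.
Qed.

Let F := hex_map H.

Definition coord_value l (i j k : bool) : R := V i j k 0 l.
Definition slack_value f (i j k : bool) : R := slack f (V i j k).

Lemma hex_mapE x l : F x 0 l = tri (coord_value l) x.
Proof.
rewrite /F /hex_map /tri summxE; apply: eq_bigr => i _.
rewrite summxE; apply: eq_bigr => j _; rewrite summxE; apply: eq_bigr => k _.
by rewrite mxE.
Qed.

Lemma slack_map f x : slack f (F x) = tri (slack_value f) x.
Proof. by rewrite /slack_value /slack triB_dot dotE !hex_mapE. Qed.

(** The k-th partial derivative of the map; it is the edge vector of E joining
    the two opposite faces when the other coordinates of x are 0 or 1. *)
Definition edge (k : 'I_3) x : 'rV[R]_3 := \row_l dtri (coord_value l) k x.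

Lemma dot_edge f k x :
  dot (hex_normal H f) (edge k x) = - dtri (slack_value f) k x.
Proof.
by rewrite /dtri -!slack_map /slack !dotE !mxE /dtri -!hex_mapE; ring.
Qed.

Lemma hex_map_set_coord k x t :
  F (set_coord x k t) = F x + (t - x 0 k) *: edge k x.
Proof. by apply/rowP => l; rewrite !mxE !hex_mapE tri_affine. Qed.

(** The rate at which the slack of the face x_k = e grows with the distance of
    x_k from e: the slack is affine in x_k and 0 for x_k = e, hence the rate is
    its value on the opposite face. *)
Definition facet_rate (k : 'I_3) (e : bool) x : R :=
  tri (slack_value (face_index k e)) (set_coord x k (~~ e)%:R).

Lemma facet_rate_gt0 k e x : ref_cube x -> 0 < facet_rate k e x.
Proof. by move=> xc; apply: tri_side_gt0 => // *; apply: slack_vertex_gt0. Qed.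

Lemma slack_on_facet k e x : tri (slack_value (face_index k e)) (set_coord x k e%:R) = 0.
Proof.
apply: tri_side_eq0 => i j l ijl; apply: slack_eq0.
by have := hex_vertex_face k i j l; rewrite ijl.
Qed.

Lemma slack_mapE k e x : slack (face_index k e) (F x) =
  (if e then 1 - x 0 k else x 0 k) * facet_rate k e x.
Proof.
rewrite slack_map; have := slack_on_facet k e x.
rewrite /facet_rate !tri_affine => /eqP; rewrite addr_eq0 => /eqP ->.
by case: e => /=; ring.
Qed.

(** Across its face the slack decreases to 0 in the outward direction. *)
Lemma dot_normal_edge k e x : x 0 k = e%:R ->
  dot (hex_normal H (face_index k e)) (edge k x) =
  side_sign e * facet_rate k e x.
Proof.
move=> xk; rewrite dot_edge /dtri /facet_rate; have := slack_on_facet k e x.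
by rewrite /side_sign; case: e {xk} => /= ->; ring.
Qed.

(** The slack vanishes on the whole face x_k = e. *)
Lemma dot_normal_edge0 k e j x : j != k -> x 0 k = e%:R ->
  dot (hex_normal H (face_index k e)) (edge j x) = 0.
Proof.
move=> jk xk; rewrite dot_edge /dtri.
have s t : tri (slack_value (face_index k e)) (set_coord x j t) = 0.
  rewrite -(set_coord_id (set_coord x j t) k) set_coordE eq_sym (negbTE jk) xk.
  exact: slack_on_facet.
by rewrite !s subrr oppr0.
Qed.

Definition edge_mx x : 'M[R]_3 := \matrix_(k, l) edge k x 0 l.

Lemma has_grad_hex_map x l :
  has_grad (fun y => F y 0 l) x (fun k => edge k x 0 l).
Proof.
apply: eq_has_grad (has_grad_tri (coord_value l) x) => [y|k]; first exact: hex_mapE.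
by rewrite mxE.
Qed.

Lemma jacobian_hex_map x : jacobian F x = edge_mx x.
Proof.
by rewrite (has_grad_jacobian (has_grad_hex_map x)); apply/matrixP => k l; rewrite !mxE.
Qed.

Lemma derive_hex_map k x : 'D_(basis_vec k) F x = edge k x.
Proof.
by rewrite (has_grad_derive k (has_grad_hex_map x)); apply/rowP => l; rewrite !mxE.
Qed.

Lemma row_mul_edge_mx c x : c *m edge_mx x = \sum_k c 0 k *: edge k x.
Proof.
by apply/rowP => l; rewrite mxE summxE; apply: eq_bigr => k _; rewrite !mxE.
Qed.

Definition secant_mx x y : 'M[R]_3 :=
  \matrix_(k, l) dtri (coord_value l) k (mix k x y).

(** An exact mean value formula, with a matrix polynomial in x and y. *)
Lemma secant_mxE x y : F y - F x = (y - x) *m secant_mx x y.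
Proof.
apply/rowP => l; rewrite !mxE !hex_mapE (tri_telescope _ x y) addrC addKr.
by apply: eq_bigr => k _; rewrite !mxE.
Qed.

Lemma secant_mx_id x : secant_mx x x = edge_mx x.
Proof. by apply/matrixP => k l; rewrite !mxE mix_id. Qed.

Hypothesis J_gt0 : forall x, ref_cube x -> 0 < hex_jac H x.

Lemma det_edge_mx_gt0 x : ref_cube x -> 0 < \det (edge_mx x).
Proof. by move=> /J_gt0; rewrite /hex_jac jacobian_hex_map. Qed.

Lemma edge_mx_unit x : ref_cube x -> edge_mx x \in unitmx.
Proof. by move=> /det_edge_mx_gt0 J0; rewrite unitmxE unitfE gt_eqF. Qed.

Lemma set_coord_cube x k t : ref_cube x -> 0 <= t <= 1 -> ref_cube (set_coord x k t).
Proof. by move=> xc t01 j; rewrite set_coordE; case: eqP. Qed.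

(** With z - F x = sum_k c_k edge_k, each term c_k (F x - z) . edge_k is
    nonnegative.  If c_k > 0, then x_k < 1, since z lies on the inner side of
    the face x_k = 1, and x_k can be increased; as F is affine in x_k, minimality
    gives (F x - z) . edge_k >= 0.  The case c_k < 0 is symmetric.  The sum of
    these terms is - |F x - z|^2. *)
Lemma dist_min_hits x0 x z r : E z -> ref_cube x -> `|x - x0| < r ->
  (forall y, ref_cube y -> `|y - x0| <= r -> sqn (F x - z) <= sqn (F y - z)) ->
  F x = z.
Proof.
move=> zE xc xr xmin.
pose c := (z - F x) *m invmx (edge_mx x).
have cE : z - F x = \sum_k c 0 k *: edge k x.
  by rewrite -row_mul_edge_mx mulmxKV// edge_mx_unit.
(* The inner product of z - F x with the normal of the face x_k = e only sees c_k. *)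
have normalE k e : x 0 k = e%:R ->
    c 0 k * (side_sign e * facet_rate k e x) <= 0.
  move=> xk; rewrite -(dot_normal_edge xk).
  have -> : c 0 k * dot (hex_normal H (face_index k e)) (edge k x) =
      dot (hex_normal H (face_index k e)) (z - F x).
    rewrite cE dot_lin (bigD1 k)//= [X in _ + X]big1 ?addr0// => j jk.
    by rewrite (dot_normal_edge0 jk xk) mulr0.
  have := slack_ge0 (face_index k e) zE.
  have : slack (face_index k e) (F x) = 0.
    by rewrite slack_mapE xk; case: e {xk} => /=; rewrite ?subrr mul0r.
  by rewrite /slack !dotE !mxE; lra.
(* First order condition in the direction s of the axis k, when it is feasible. *)
have step k s : (s = 1 \/ s = -1) -> (exists2 d, 0 < d &
    forall t, 0 < t <= d -> 0 <= x 0 k + s * t <= 1) ->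
    0 <= s * dot (F x - z) (edge k x).
  move=> s1 [d d0 dP]; apply: (@one_sided_min _ (sqn (edge k x)) (Num.min d (r - `|x - x0|))).
    by rewrite lt_min d0 subr_gt0.
  move=> t /andP[t0]; rewrite le_min => /andP[td tr].
  have yc : ref_cube (set_coord x k (x 0 k + s * t)).
    by apply: set_coord_cube => //; apply: dP; rewrite t0.
  have yr : `|set_coord x k (x 0 k + s * t) - x0| <= r.
    rewrite -(subrK x (set_coord _ _ _)) -addrA (le_trans (ler_normD _ _))//.
    rewrite -lerBrDr (le_trans (norm_set_coord _ _ _))//.
    rewrite (_ : x 0 k + s * t - x 0 k = s * t); last by ring.
    have sn : `|s| = 1 by case: s1 => ->; rewrite ?normrN1 ?normr1.
    by rewrite normrM sn mul1r gtr0_norm.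
  have := xmin _ yc yr.
  rewrite hex_map_set_coord -subr_ge0 addrC.
  have -> : x 0 k + s * t - x 0 k = s * t by ring.
  have ss : s * s = 1 by case: s1 => ->; rewrite ?mulrNN mulr1.
  congr (_ <= _); rewrite /sqn !dotE !mxE -[t ^+ 2]mul1r -ss; ring.
have sgn k : 0 <= c 0 k * dot (F x - z) (edge k x).
  have /andP[x0k x1k] := xc k.
  have [c0|c0|->] := ltrgtP (c 0 k) 0; last by rewrite mul0r.
    rewrite -mulrNN mulr_ge0 ?oppr_ge0//; first exact: ltW.
    rewrite -oppr_ge0 -mulN1r; apply: step; first by right.
    exists (x 0 k); last by move=> t; lra.
    rewrite lt0r x0k andbT; apply/eqP => xk.
    have := normalE k false xk; rewrite nmulr_rle0// /side_sign mulN1r oppr_ge0.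
    by rewrite leNgt facet_rate_gt0.
  rewrite mulr_ge0//; first exact: ltW.
  rewrite -[X in 0 <= X]mul1r; apply: step; first by left.
  exists (1 - x 0 k); last by move=> t; lra.
  rewrite subr_gt0 lt_neqAle x1k andbT; apply/eqP => xk.
  have := normalE k true xk; rewrite pmulr_rle0// /side_sign mul1r.
  by rewrite leNgt facet_rate_gt0.
apply/eqP; rewrite -subr_eq0; apply/eqP/sqn_eq0.
have -> : sqn (F x - z) = - \sum_k c 0 k * dot (F x - z) (edge k x).
  by rewrite -dot_lin -cE /sqn !dotE !mxE; ring.
by rewrite oppr_le0 sumr_ge0.
Qed.

End Geometry.

(** * The trilinear map is a bijection of the cube onto the hexahedron *)

Section Continuity.
Context {R : realType}.

Lemma det_cvg (n : nat) (T : Type) (F : set_system T) (FF : Filter F)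
    (A : T -> 'M[R]_n) (B : 'M[R]_n) :
  (forall i j, A t i j @[t --> F] --> B i j) ->
  \det (A t) @[t --> F] --> \det B.
Proof.
move=> AB; apply: cvg_big => [|s _]; first exact: add_continuous.
apply: cvgM; first exact: cvg_cst.
by apply: cvg_big => [|i _]; [exact: mul_continuous|exact: AB].
Qed.

Lemma adj_cvg (n : nat) (T : Type) (F : set_system T) (FF : Filter F)
    (A : T -> 'M[R]_n) (B : 'M[R]_n) i j :
  (forall i j, A t i j @[t --> F] --> B i j) ->
  (\adj (A t)) i j @[t --> F] --> (\adj B) i j.
Proof.
move=> AB; rewrite mxE; under eq_fun do rewrite mxE.
apply: cvgM; first exact: cvg_cst.
apply: det_cvg => a b; rewrite !mxE; under eq_fun do rewrite !mxE.
exact: AB.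
Qed.

Lemma sqn_cvg (T : Type) (F : set_system T) (FF : Filter F)
    (g : T -> 'rV[R]_3) (y : 'rV[R]_3) :
  (forall j, g t 0 j @[t --> F] --> y 0 j) -> sqn (g t) @[t --> F] --> sqn y.
Proof. by move=> gy; apply: cvg_sum_ord3 => j; apply: cvgM; exact: gy. Qed.

Lemma ref_cube_compact : compact (@ref_cube R).
Proof.
have := @rV_compact R 3 (fun=> `[0, 1]%classic) (fun=> @segment_compact R 0 1).
congr compact; apply/seteqP; split => x /= H j; have := H j; by rewrite in_itv.
Qed.

Lemma ref_cube_norm (x : 'rV[R]_3) : ref_cube x -> `|x| <= 1.
Proof.
move=> xc; rewrite [leLHS]/Num.norm/= mx_normrE; apply/bigmax_leP.
split => // -[i j] _ /=; rewrite ord1; have /andP[x0 x1] := xc j.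
by rewrite ger0_norm.
Qed.

Lemma sqnD_le (u v : 'rV[R]_3) : sqn (u + v) <= 2 * sqn u + 2 * sqn v.
Proof.
rewrite -subr_ge0.
have -> : 2 * sqn u + 2 * sqn v - sqn (u + v) = sqn (u - v).
  by rewrite /sqn !dotE !mxE; ring.
exact: sqn_ge0.
Qed.

Lemma sqnN (u : 'rV[R]_3) : sqn (- u) = sqn u.
Proof. by rewrite /sqn !dotE !mxE; ring. Qed.

End Continuity.

Section Bijection.
Context {R : realType}.
Implicit Types (x y z u v : 'rV[R]_3) (k : 'I_3) (e : bool).
Variable H : hexahedron R.
Hypothesis J_gt0 : forall x, ref_cube x -> 0 < hex_jac H x.
Let F := hex_map H.
Let E := hex_set H.

Lemma hex_map_cvg (T : Type) (G : set_system T) (FG : Filter G)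
    (g : T -> 'rV[R]_3) y l :
  (forall j, g t 0 j @[t --> G] --> y 0 j) -> F (g t) 0 l @[t --> G] --> F y 0 l.
Proof.
move=> gy; rewrite hex_mapE; under eq_fun do rewrite hex_mapE.
exact: tri_cvg.
Qed.

Lemma secant_mx_cvg (T : Type) (G : set_system T) (FG : Filter G)
    (g h : T -> 'rV[R]_3) x y k l :
  (forall j, g t 0 j @[t --> G] --> x 0 j) ->
  (forall j, h t 0 j @[t --> G] --> y 0 j) ->
  secant_mx H (g t) (h t) k l @[t --> G] --> secant_mx H x y k l.
Proof.
move=> gx hy; rewrite mxE; under eq_fun do rewrite mxE.
by apply: dtri_cvg => j; apply: mix_cvg.
Qed.

Lemma dist_continuous z : continuous (fun y => sqn (F y - z)).
Proof.
move=> y; apply: (@sqn_cvg _ _ (nbhs y)) => j.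
rewrite !mxE; under eq_fun do rewrite !mxE.
apply: (@cvgB _ _ _ (nbhs y)); last exact: cst_cvg.
by apply: (@hex_map_cvg _ (nbhs y)) => i; exact: coord_cvg.
Qed.

Lemma hex_map_in x : ref_cube x -> E (F x).
Proof.
move=> xc f; rewrite -subr_ge0 -/(slack H f (F x)) slack_map.
by apply: tri_ge0 => // i j k; apply: slack_ge0; exact: vertex_in_hex.
Qed.

Lemma hex_map_surj z : E z -> exists2 x, ref_cube x & F x = z.
Proof.
move=> zE; have [||x] := @compact_EVT_min _ R (fun y => sqn (F y - z)) _ _ ref_cube_compact.
- by exists 0 => j; rewrite mxE lexx ler01.
- exact/continuous_subspaceT/dist_continuous.
rewrite inE => xc xmin; exists x => //.
(* The cube is contained in the open ball of radius 2 about 0. *)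
apply: (@dist_min_hits _ H J_gt0 0 x z 2) => //.
  by rewrite subr0 (le_lt_trans (ref_cube_norm xc))// ltr1n.
by move=> y yc _; apply: xmin; rewrite inE.
Qed.

Lemma det_secant_id x : ref_cube x -> \det (secant_mx H x x) != 0.
Proof. by move=> xc; rewrite secant_mx_id gt_eqF// det_edge_mx_gt0. Qed.

(** Conversely the determinant is positive for x = y: on the pairs with the same
    image, a closed condition separates x <> y from x = y. *)
Lemma det_secant_eq0 x y : F x = F y -> x != y -> \det (secant_mx H x y) = 0.
Proof.
move=> Fxy xy; apply/eqP; apply: contraNT xy => d0.
have U : secant_mx H x y \in unitmx by rewrite unitmxE unitfE.
have := secant_mxE H x y; rewrite -/F Fxy subrr => /(congr1 (mulmx^~ (invmx (secant_mx H x y)))).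
by rewrite mul0mx mulmxK// => /eqP; rewrite eq_sym subr_eq0 eq_sym.
Qed.

Lemma det_secant_near x : ref_cube x -> \forall y \near x, \det (secant_mx H x y) != 0.
Proof.
move=> xc; have : \det (secant_mx H x y) @[y --> x] --> \det (secant_mx H x x).
  apply: (@det_cvg _ _ _ (nbhs x)) => i j; apply: (@secant_mx_cvg _ (nbhs x)) => l.
    exact: cst_cvg.
  exact: coord_cvg.
by move=> /cvgr_neq0; apply; exact: det_secant_id.
Qed.

(** F - F x0 does not vanish on a small sphere about x0 intersected with the
    cube, hence |F - F x0|^2 is at least some mu > 0 there.  If
    |z - F x0|^2 < mu / 4, then the minimum of |F - z|^2 on the ball is not
    attained on the sphere, and dist_min_hits applies. *)
Lemma hex_map_open x0 r : ref_cube x0 -> 0 < r ->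
  exists2 eta, 0 < eta & forall z, E z -> sqn (z - F x0) < eta ->
    exists x, [/\ ref_cube x, `|x - x0| < r & F x = z].
Proof.
move=> x0c r0.
have /nbhs_ballP[rho /= rho0 rhoP] := det_secant_near x0c.
pose s := Num.min r rho / 2.
have s0 : 0 < s by rewrite divr_gt0// lt_min r0 rho0.
have [sr srho] : s < r /\ s < rho.
  have m0 : 0 < Num.min r rho by rewrite lt_min r0 rho0.
  have : Num.min r rho <= r by rewrite ge_min lexx.
  have : Num.min r rho <= rho by rewrite ge_min lexx orbT.
  by rewrite /s; split; lra.
have ncont : continuous (fun y => `|y - x0|).
  move=> y; apply: (@cvg_norm _ _ _ (nbhs y)).
  by apply: (@cvgB _ _ _ (nbhs y)); [exact: cvg_id|exact: (@cvg_cst _ _ _ (nbhs y))].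
have inj y : ref_cube y -> `|y - x0| = s -> 0 < sqn (F y - F x0).
  move=> yc ys; rewrite lt0r sqn_ge0 andbT; apply/eqP => sq0.
  have Fy : F x0 = F y.
    by apply/esym/eqP; rewrite -subr_eq0; apply/eqP/sqn_eq0; rewrite sq0.
  have yx : x0 != y.
    by apply/eqP => yx; move: s0; rewrite -ys yx subrr normr0 ltxx.
  have := rhoP y; rewrite -ball_normE /= distrC ys => /(_ srho).
  by rewrite det_secant_eq0 ?eqxx.
have [mu mu0 muP] : exists2 mu, 0 < mu &
    forall y, ref_cube y -> `|y - x0| = s -> mu <= sqn (F y - F x0).
  pose A := @ref_cube R `&` [set y | `|y - x0| = s].
  have cA : compact A.
    apply: compact_closedI; first exact: ref_cube_compact.
    have /continuous_closedP := ncont; move=> /(_ [set s]); apply.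
    exact: closed_eq.
  have [A0|/set0P/negP/negPn/eqP A0] := pselect (A !=set0); last first.
    exists 1 => // y yc ys; suff : A y by rewrite A0.
    by [].
  have [|y] := compact_EVT_min A0 cA (f := fun y => sqn (F y - F x0)).
    exact/continuous_subspaceT/dist_continuous.
  rewrite inE => -[yc ys] ymin; exists (sqn (F y - F x0)); first exact: inj.
  by move=> t tc ts; apply: ymin; rewrite inE.
exists (mu / 4) => [|z zE zx0]; first by rewrite divr_gt0.
pose C := @ref_cube R `&` [set y | `|y - x0| <= s].
have cC : compact C.
  apply: compact_closedI; first exact: ref_cube_compact.
  by have /continuous_closedP := ncont; move=> /(_ [set t | t <= s]); apply; exact: closed_le.
have C0 : C x0 by split => //=; rewrite subrr normr0 ltW.
have [||x] := compact_EVT_min _ cC (f := fun y => sqn (F y - z)).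
- by exists x0.
- exact/continuous_subspaceT/dist_continuous.
rewrite inE => -[xc xs] xmin.
have xx0 : `|x - x0| < s.
  rewrite lt_neqAle xs andbT; apply/eqP => xse.
  have := muP x xc xse; rewrite leNgt => /negP; apply.
  have -> : F x - F x0 = (F x - z) + (z - F x0) by rewrite addrA subrK.
  have := sqnD_le (F x - z) (z - F x0).
  have : sqn (F x - z) <= sqn (z - F x0).
    by rewrite -[leRHS]sqnN opprB; apply: xmin; rewrite inE.
  by move: zx0; lra.
exists x; split => //; first exact: lt_trans sr.
apply: (@dist_min_hits _ H J_gt0 x0 x z s) => // y yc ys.
by apply: xmin; rewrite inE.
Qed.

(** S is the set of pairs of distinct points of the cube with the same image.  It
    is compact, being cut out by the vanishing of h.  Let ell be the sum of the
    slacks of the faces 0, 2, 4, and p a pair in S whose image z minimises ell.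
    If ell z = 0, both points are the origin.  Otherwise the point w of the
    segment from z to the vertex v common to these faces has ell w < ell z, and,
    if w is close to z, it is again the image of two distinct points of the
    cube. *)
Lemma hex_map_inj x y : ref_cube x -> ref_cube y -> F x = F y -> x = y.
Proof.
move=> xc yc Fxy; apply: contrapT => xy.
pose h (p : 'rV[R]_3 * 'rV[R]_3) :=
  sqn (F p.1 - F p.2) + \det (secant_mx H p.1 p.2) ^+ 2.
have c1 (p : 'rV[R]_3 * 'rV[R]_3) j :
    (fun q : 'rV[R]_3 * 'rV[R]_3 => q.1 0 j) @ p --> p.1 0 j.
  exact: (cvg_comp _ _ (@cvg_fst _ _ (nbhs p.1) (nbhs p.2) _) (@coord_cvg R p.1 j)).
have c2 (p : 'rV[R]_3 * 'rV[R]_3) j :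
    (fun q : 'rV[R]_3 * 'rV[R]_3 => q.2 0 j) @ p --> p.2 0 j.
  exact: (cvg_comp _ _ (@cvg_snd _ _ (nbhs p.1) (nbhs p.2) _) (@coord_cvg R p.2 j)).
have hc : continuous h.
  move=> p; apply: (@cvgD _ _ _ (nbhs p)).
    apply: (@sqn_cvg _ _ (nbhs p)) => j; rewrite !mxE; under eq_fun do rewrite !mxE.
    apply: (@cvgB _ _ _ (nbhs p)); apply: (@hex_map_cvg _ (nbhs p)) => l.
      exact: (c1 p).
    exact: (c2 p).
  rewrite expr2; under eq_fun do rewrite expr2.
  by apply: (@cvgM _ _ (nbhs p)); apply: (@det_cvg _ _ _ (nbhs p)) => i j;
    (apply: (@secant_mx_cvg _ (nbhs p)) => l; [exact: (c1 p)|exact: (c2 p)]).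
pose S := (@ref_cube R `*` @ref_cube R) `&` [set p | h p = 0].
have SP p : S p <-> [/\ ref_cube p.1, ref_cube p.2, F p.1 = F p.2 & p.1 != p.2].
  split=> [[[p1 p2] /= hp]|[p1 p2 Fp pne]].
    have := sqn_ge0 (F p.1 - F p.2); have := sqr_ge0 (\det (secant_mx H p.1 p.2)).
    rewrite -/(h p) in hp; move: hp; rewrite /h => hp d2 s2.
    have d0 : \det (secant_mx H p.1 p.2) = 0.
      by apply/eqP; rewrite -sqrf_eq0; apply/eqP; lra.
    have F0 : F p.1 - F p.2 = 0 by apply: sqn_eq0; lra.
    split => //; first by apply/eqP; rewrite -subr_eq0 F0.
    apply/eqP => pp; have := det_secant_id p1; rewrite {2}pp d0.
    by rewrite eqxx.
  split => //=; rewrite /h Fp subrr det_secant_eq0// expr0n addr0.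
  by rewrite /sqn dotE !mxE !mulr0 !addr0.
have cS : compact S.
  apply: compact_closedI; first exact/compact_setX/ref_cube_compact/ref_cube_compact.
  by have /continuous_closedP := hc; move=> /(_ [set 0]); apply; exact: closed_eq.
have Sxy : S (x, y) by apply/SP; split => //; apply/eqP.
pose ell z := \sum_k slack H (face_index k false) z.
have [||p] := compact_EVT_min _ cS (f := fun p => ell (F p.1)).
- by exists (x, y).
- apply: continuous_subspaceT => p; apply: (@cvg_sum_ord3 _ _ (nbhs p)) => k.
  rewrite slack_map; under eq_fun do rewrite slack_map.
  apply: (@tri_cvg _ _ _ (nbhs p)) => l; exact: (c1 p).
rewrite inE => /SP[p1c p2c Fp pne] pmin.
set z := F p.1 in Fp pmin.
have zE : E z by apply: hex_map_in.
have slack0 k : 0 <= slack H (face_index k false) z by apply: slack_ge0.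
have [ell0|ell_gt0] : ell z <= 0 \/ 0 < ell z.
  by case: (leP (ell z) 0) => [?|?]; [left|right].
  have coord0 q : ref_cube q -> F q = z -> q = 0.
    move=> qc qz; have s0 k : slack H (face_index k false) z = 0.
      apply/eqP; rewrite eq_le slack0 andbT (le_trans _ ell0)//.
      by rewrite /ell (bigD1 k)//= lerDl sumr_ge0.
    apply/rowP => k; rewrite mxE; have := s0 k; rewrite -qz slack_mapE => /eqP.
    by rewrite mulf_eq0 (gt_eqF (facet_rate_gt0 _ _ _ qc)) orbF => /eqP.
  by move: pne; rewrite (coord0 p.1)// (coord0 p.2)// eqxx.
pose r := `|p.1 - p.2| / 2.
have r0 : 0 < r by rewrite divr_gt0// normr_gt0 subr_eq0.
have [e1 e10 e1P] := hex_map_open p1c r0.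
have [e2 e20 e2P] := hex_map_open p2c r0.
pose v := hex_vertex H false false false.
pose m := Num.min e1 e2.
have m0 : 0 < m by rewrite lt_min e10.
pose q := sqn (v - z) + 1.
have q0 : 0 < q by rewrite ltr_wpDl// sqn_ge0.
(* As |w - z|^2 = t^2 |v - z|^2 <= t q < m, the point w is in the range of both
   applications of hex_map_open. *)
pose t := Num.min 1 (m / (2 * q)).
have t0 : 0 < t by rewrite lt_min ltr01 divr_gt0// mulr_gt0.
have t1 : t <= 1 by rewrite ge_min lexx.
have tm : t * (2 * q) <= m by rewrite -ler_pdivlMr ?mulr_gt0// ge_min lexx orbT.
pose w := z + t *: (v - z).
have slackw f : slack H f w = (1 - t) * slack H f z + t * slack H f v.
  by rewrite /slack /w !dotE !mxE; ring.
have wE : E w.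
  move=> f; rewrite -subr_ge0 -/(slack H f w) slackw.
  have t1' : 0 <= 1 - t by rewrite subr_ge0.
  have vs : 0 <= slack H f v by apply: slack_ge0; exact: vertex_in_hex.
  by apply: addr_ge0; apply: mulr_ge0 => //; [exact: slack_ge0|exact: ltW].
have wz : sqn (w - z) < m.
  have -> : sqn (w - z) = t ^+ 2 * sqn (v - z) by rewrite /sqn /w !dotE !mxE; ring.
  have := sqn_ge0 (v - z); move: tm t0 t1; rewrite /q; nra.
have [x' [x'c x'r x'w]] : exists x', [/\ ref_cube x', `|x' - p.1| < r & F x' = w].
  by apply: e1P => //; rewrite (lt_le_trans wz)// ge_min lexx.
have [y' [y'c y'r y'w]] : exists y', [/\ ref_cube y', `|y' - p.2| < r & F y' = w].
  by apply: e2P => //; rewrite -Fp (lt_le_trans wz)// ge_min lexx orbT.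
have xy' : x' != y'.
  apply/eqP => xy'; move: y'r; rewrite -xy' => y'r.
  have : `|p.1 - p.2| < r + r.
    rewrite (_ : p.1 - p.2 = (x' - p.2) - (x' - p.1)); last first.
      by apply/rowP => i; rewrite !mxE; ring.
    by rewrite (le_lt_trans (ler_normB _ _))// ltrD.
  by rewrite /r; lra.
have : ell z <= ell w.
  rewrite -x'w; apply: (pmin (x', y')); rewrite inE; apply/SP.
  by rewrite /= x'w y'w.
have -> : ell w = (1 - t) * ell z.
  rewrite /ell !sum_ord3 !slackw !(@slack_eq0 _ H _ v); first by ring.
  - exact: (hex_vertex_face H 2 false false false).
  - exact: (hex_vertex_face H 1 false false false).
  - exact: (hex_vertex_face H 0 false false false).
by nra.
Qed.

Let G := hex_ref_point H.

Lemma hex_ref_pointP z : E z -> ref_cube (G z) /\ F (G z) = z.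
Proof.
move=> /hex_map_surj[x xc xz].
by apply: (@xgetPex _ 0 [set xh | ref_cube xh /\ hex_map H xh = z]); exists x.
Qed.

Lemma hex_ref_point_cvg z j : (\near z, E z) -> G w 0 j @[w --> z] --> G z 0 j.
Proof.
move=> zn; have zE := nbhs_singleton zn.
have [Gc Gz] := hex_ref_pointP zE.
apply/(@cvgrPdist_lt _ _ _ (nbhs z)) => r r0.
have [eta eta0 etaP] := hex_map_open Gc r0.
have near_eta : \forall w \near z, sqn (w - F (G z)) < eta.
  rewrite Gz; have c : sqn (w - z) @[w --> z] --> sqn (z - z).
    apply: (@sqn_cvg _ _ (nbhs z)) => i; rewrite !mxE; under eq_fun do rewrite !mxE.
    apply: (@cvgB _ _ _ (nbhs z)); [exact: coord_cvg|exact: cst_cvg].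
  have s0 : sqn (z - z) = 0 :> R by rewrite /sqn dotE !mxE; ring.
  rewrite s0 in c.
  have /cvgr_lt := c; apply; exact: eta0.
apply: filterS2 zn near_eta => w wE wz.
have [x [xc xr xw]] := etaP w wE wz.
have [Gwc Gw] := hex_ref_pointP wE.
have -> : G w = x by apply: hex_map_inj => //; rewrite Gw.
rewrite distrC; apply: le_lt_trans xr.
by have := coord_le_norm (x - G z) j; rewrite !mxE.
Qed.

(** Inverting the secant formula, G w - G z = (w - z) M(G z, G w)^-1, and the
    right-hand matrix is continuous in w. *)
Lemma has_grad_hex_ref_point z j : (\near z, E z) ->
  has_grad (fun w => G w 0 j) z (fun k => invmx (edge_mx H (G z)) k j).
Proof.
move=> zn; have zE := nbhs_singleton zn.
have [Gc Gz] := hex_ref_pointP zE.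
have U := edge_mx_unit J_gt0 Gc.
pose A w := secant_mx H (G z) (G w).
have Ac k l : A w k l @[w --> z] --> edge_mx H (G z) k l.
  rewrite -secant_mx_id; apply: (@secant_mx_cvg _ (nbhs z)) => i.
    exact: cst_cvg.
  exact: hex_ref_point_cvg.
have detc : \det (A w) @[w --> z] --> \det (edge_mx H (G z)).
  exact: (@det_cvg _ _ _ (nbhs z)).
have det0 : \det (edge_mx H (G z)) != 0 by rewrite -unitfE -unitmxE.
exists (fun k w => (\det (A w))^-1 * (\adj (A w)) k j) => [k|].
  rewrite /invmx U mxE; apply: (@cvgM _ _ (nbhs z)).
    exact: (@cvgV _ _ (nbhs z)).
  exact: (@adj_cvg _ _ _ (nbhs z)).
have near_unit : \forall w \near z, \det (A w) != 0.
  by move: detc => /cvgr_neq0; apply.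
apply: filterS2 zn near_unit => w wE dw.
have [Gwc Gw] := hex_ref_pointP wE.
have Aw : A w \in unitmx by rewrite unitmxE unitfE.
have := secant_mxE H (G z) (G w); rewrite -/F Gz Gw -/(A w).
move=> /(congr1 (mulmx^~ (invmx (A w)))); rewrite mulmxK// => GE.
have /rowP/(_ j) := GE; rewrite !mxE => GEj.
rewrite -[G w 0 j](subrK (G z 0 j)) -GEj addrC; congr (_ + _).
by apply: eq_bigr => k _; rewrite /invmx Aw !mxE.
Qed.

End Bijection.

(** * The Piola transform *)

Lemma ord3_addE :
  ((0 + 1 = 1 :> 'I_3)%R * (1 + 1 = 2 :> 'I_3)%R * (2 + 1 = 0 :> 'I_3)%R *
   (0 + 2 = 2 :> 'I_3)%R * (1 + 2 = 0 :> 'I_3)%R * (2 + 2 = 1 :> 'I_3)%R)%type.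
Proof. by do !split; apply: val_inj. Qed.

Section Det3.
Context {R : comPzRingType}.
Implicit Types A : 'M[R]_3.

(** With indices mod 3, the cofactors of a matrix of order 3 carry no sign. *)
Definition cof A (k l : 'I_3) : R :=
  A (k + 1) (l + 1) * A (k + 2) (l + 2) - A (k + 1) (l + 2) * A (k + 2) (l + 1).

Lemma det3E A : \det A = A 0 0 * cof A 0 0 + A 0 1 * cof A 0 1 + A 0 2 * cof A 0 2.
Proof.
pose f (i j : nat) := A (inord i) (inord j).
have -> : A = \matrix_(i, j) f i j by apply/matrixP => i j; rewrite mxE /f !inord_val.
rewrite (expand_det_row _ 0) sum_ord3 /cofactor.
rewrite !(expand_det_row _ (0 : 'I_2)) !big_ord_recl !big_ord0 /cofactor !det_mx11.
rewrite /cof !ord3_addE !mxE /= /bump /=.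
by rewrite !exprS !expr0; ring.
Qed.

Lemma cof_expand A i k : \sum_l A i l * cof A k l = (\det A) *+ (i == k).
Proof.
rewrite det3E !sum_ord3 /cof.
by elim/ord3_ind: i; elim/ord3_ind: k; rewrite !ord3_addE ?mulr0n ?mulr1n /=; ring.
Qed.

End Det3.

Lemma invmx3 (R : fieldType) (A : 'M[R]_3) : A \in unitmx ->
  invmx A = \matrix_(l, k) ((\det A)^-1 * cof A k l).
Proof.
move=> U; have d0 : \det A != 0 by rewrite -unitfE -unitmxE.
rewrite -[RHS](mulKmx U); rewrite (_ : A *m _ = 1%:M) ?mulmx1//.
apply/matrixP => i k; rewrite !mxE.
under eq_bigr do rewrite mxE mulrCA.
by rewrite -mulr_sumr cof_expand mulrnAr mulVf.
Qed.

Section Piola.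
Context {R : realType}.
Implicit Types (x y z u v : 'rV[R]_3) (k j : 'I_3) (e : bool).

Lemma has_grad_det (A : 'rV[R]_3 -> 'M[R]_3) x (dA : 'I_3 -> 'I_3 -> 'I_3 -> R) :
  (forall k l, has_grad (fun y => A y k l) x (dA k l)) ->
  has_grad (fun y => \det (A y)) x
    (fun m => \sum_k \sum_l cof (A x) k l * dA k l m).
Proof.
move=> dAP.
have M k l k' l' := has_gradM (dAP k l) (dAP k' l').
have C k l := has_gradD (M (k + 1) (l + 1) (k + 2) (l + 2))
  (has_gradM (has_grad_cst (-1) x) (M (k + 1) (l + 2) (k + 2) (l + 1))).
have T l := has_gradM (dAP 0 l) (C 0 l).
apply: eq_has_grad (has_gradD (has_gradD (T 0) (T 1)) (T 2)) => [y|m].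
  by rewrite det3E /cof; ring.
by rewrite !sum_ord3 /cof !ord3_addE; ring.
Qed.

Variable H : hexahedron R.
Hypothesis J_gt0 : forall x, ref_cube x -> 0 < hex_jac H x.
Let F := hex_map H.
Let E := hex_set H.
Let G := hex_ref_point H.
Let D := edge_mx H.

Lemma hex_jacE x : hex_jac H x = \det (D x).
Proof. by rewrite /hex_jac jacobian_hex_map. Qed.

Lemma has_grad_edge_mx k l x :
  has_grad (fun y => D y k l) x (ddtri (coord_value H l) k x).
Proof.
by apply: eq_has_grad (has_grad_dtri (coord_value H l) k x) => // y; rewrite !mxE.
Qed.

(** With D the Jacobian matrix, J = det D and C the cofactor matrix, the
    transform of v is, up to the change of variable, sum_i v_i D_i / J with D_i
    the i-th row, and the chain rule contracts its derivatives with C / J.  The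
    terms in the derivatives of v give div v / J.  The terms in the second
    derivatives of F and those in the derivatives of 1 / J cancel, since
    d_m J = sum_ij C_ij d_m D_ij and d_m D_ij = d_i D_mj. *)
Lemma has_div_piola (v : 'rV[R]_3 -> 'rV[R]_3) z d : (\near z, E z) ->
  has_div v (G z) d -> has_div (piola H v) z ((\det (D (G z)))^-1 * d).
Proof.
move=> zn [b vb <-]; have zE := nbhs_singleton zn.
have [xc _] := hex_ref_pointP J_gt0 zE.
set x := G z in xc vb *.
have U := edge_mx_unit J_gt0 xc; rewrite -/D in U.
have d0 : \det (D x) != 0 by rewrite -unitfE -unitmxE.
have dJ := has_gradV d0 (has_grad_det (fun k l => has_grad_edge_mx k l x)).
have dw j := has_gradM dJ (has_grad_sum (index_enum 'I_3) (P := xpredT)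
  (fun k _ => has_gradM (vb k) (has_grad_edge_mx k j x))).
have dG j := has_grad_hex_ref_point J_gt0 j zn.
have dp j := has_grad_comp dG (dw j).
eexists => [j|].
  apply: eq_has_grad (dp j) => [w|k]; last by [].
  rewrite /piola /= jacobian_hex_map hex_jacE !mxE; congr (_ * _).
under eq_bigr => j _ do under eq_bigr => m _ do
  rewrite -/(G z) -/x (invmx3 U) mxE -/(D x).
pose S k := \sum_m \sum_l cof (D x) m l * ddtri (coord_value H l) m x k.
have SE k : S k = \sum_m \sum_l cof (D x) m l * ddtri (coord_value H l) k x m.
  by apply: eq_bigr => m _; apply: eq_bigr => l _; rewrite ddtri_sym.
set P := \det (D x) in d0 *.
have pick (c : 'I_3 -> R) m : \sum_i c i * (\sum_j D x i j * cof (D x) m j) = P * c m.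
  under eq_bigr do rewrite cof_expand -/P.
  by elim/ord3_ind: m; rewrite sum_ord3 /=; ring.
rewrite exchange_big /=.
have column m : \sum_j
    (P^-1 * (\sum_i (v x 0 i * ddtri (coord_value H j) i x m + b i m * D x i j)) +
     - S m / P / P * (\sum_i v x 0 i * D x i j)) * (P^-1 * cof (D x) m j) =
    P^-1 * (P^-1 * (\sum_i v x 0 i * \sum_j cof (D x) m j * ddtri (coord_value H j) i x m) + b m m
            - P^-1 * (v x 0 m * S m)).
  transitivity (P^-1 * (P^-1 * (\sum_i v x 0 i *
        (\sum_j cof (D x) m j * ddtri (coord_value H j) i x m)
      + \sum_i b i m * (\sum_j D x i j * cof (D x) m j))
      - S m / P / P * \sum_i v x 0 i * (\sum_j D x i j * cof (D x) m j))).
    by rewrite !sum_ord3; ring.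
  by rewrite (pick (b^~ m)) (pick (fun i => v x 0 i)); field.
under eq_bigr do rewrite column.
rewrite -mulr_sumr; congr (_ * _).
rewrite !(sumrB, big_split) /= -!mulr_sumr exchange_big /=.
under [in X in X + _ - _]eq_bigr do rewrite -mulr_sumr -SE.
by ring.
Qed.

Lemma piola_divergence_free (v : 'rV[R]_3 -> 'rV[R]_3) :
  (forall x, has_div v x 0) -> divergence_free H (piola H v).
Proof.
move=> vdiv z zint; have := has_div_piola zint (vdiv (G z)).
by rewrite mulr0 => /has_div_divergence.
Qed.

(** The signed face Jacobian: on the face x_k = e the cross product of the two
    tangent derivatives is this multiple of the outer normal.  Being free of
    square roots, it is visibly a polynomial. *)
Definition face_flux k e x : R :=
  dot (hex_normal H (face_index k e)) (cross (edge H (k + 1) x) (edge H (k + 2) x)).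

Lemma crossE u v : ((cross u v 0 0 = u 0 1 * v 0 2 - u 0 2 * v 0 1) *
  (cross u v 0 1 = u 0 2 * v 0 0 - u 0 0 * v 0 2) *
  (cross u v 0 2 = u 0 0 * v 0 1 - u 0 1 * v 0 0))%type.
Proof. by rewrite /cross /vec3 !mxE. Qed.

(** Two vectors orthogonal to the unit vector n have a cross product parallel
    to n. *)
Lemma dot_cross_tangent (n d u w : 'rV[R]_3) :
  dot n n = 1 -> dot n u = 0 -> dot n w = 0 ->
  dot d (cross u w) = dot n d * dot n (cross u w).
Proof.
move=> nn nu nw.
(* Cramer's identity between the four vectors d, n, u, w, paired with n. *)
have id : dot d (cross u w) * dot n n = dot n d * dot n (cross u w)
    + dot n u * dot d (cross n w) + dot n w * dot d (cross u n).
  by rewrite !dotE !crossE; ring.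
by rewrite nn nu nw !mul0r !addr0 mulr1 in id.
Qed.

Lemma normal_sqn f : dot (hex_normal H f) (hex_normal H f) = 1.
Proof.
have := hex_normal_unit H f; rewrite /enorm => /(congr1 (fun t => t ^+ 2)).
by rewrite sqr_sqrtr ?expr1n//; exact: sqn_ge0.
Qed.

Lemma dot_cross_edge k e d x : x 0 k = e%:R ->
  dot d (cross (edge H (k + 1) x) (edge H (k + 2) x)) =
  dot (hex_normal H (face_index k e)) d * face_flux k e x.
Proof.
move=> xk; apply: dot_cross_tangent; first exact: normal_sqn.
  by apply: dot_normal_edge0 => //; elim/ord3_ind: k {xk}; rewrite ord3_addE.
by apply: dot_normal_edge0 => //; elim/ord3_ind: k {xk}; rewrite ord3_addE.
Qed.

Lemma det_edge_mxE k x : \det (D x) =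
  dot (edge H k x) (cross (edge H (k + 1) x) (edge H (k + 2) x)).
Proof.
have DE i j : D x i j = edge H i x 0 j by rewrite mxE.
rewrite det3E /cof dotE !crossE !DE.
by elim/ord3_ind: k; rewrite !ord3_addE; ring.
Qed.

Lemma face_jacobian k e x : x 0 k = e%:R ->
  \det (D x) = side_sign e * facet_rate H k e x * face_flux k e x.
Proof. by move=> xk; rewrite (det_edge_mxE k) (dot_cross_edge _ xk) dot_normal_edge. Qed.

Lemma face_flux_gt0 k e x : ref_cube x -> x 0 k = e%:R ->
  0 < side_sign e * face_flux k e x.
Proof.
move=> xc xk; have := det_edge_mx_gt0 J_gt0 xc; rewrite -/D (face_jacobian xk).
by rewrite mulrAC pmulr_lgt0// facet_rate_gt0.
Qed.

Lemma hex_face_ref k e z : hex_face H (face_index k e) z ->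
  [/\ ref_cube (G z), F (G z) = z & G z 0 k = e%:R].
Proof.
move=> zf; have zE : E z by case: zf.
have [xc xz] := hex_ref_pointP J_gt0 zE; split => //.
have := slack_eq0 zf; rewrite -{1}xz slack_mapE => /eqP.
rewrite mulf_eq0 (gt_eqF (facet_rate_gt0 _ _ _ xc)) orbF.
by case: e {zf} => /eqP; [move=> /subr0_eq <-|].
Qed.

(** In nu . sum_j w_j edge_j / J only the term j = k is left, and
    J = (nu . edge_k) face_flux. *)
Lemma piola_flux (w : 'rV[R]_3 -> 'rV[R]_3) k e z : hex_face H (face_index k e) z ->
  dot (piola H w z) (hex_normal H (face_index k e)) = w (G z) 0 k / face_flux k e (G z).
Proof.
move=> zf; have [xc xz xk] := hex_face_ref zf.
have pE : piola H w z =
    \sum_j (((\det (D (G z)))^-1 *: w (G z)) : 'rV[R]_3) 0 j *: edge H j (G z).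
  by rewrite /piola jacobian_hex_map hex_jacE -row_mul_edge_mx -scalemxAl.
have dotC a b : dot a b = dot b a by rewrite !dotE; ring.
rewrite dotC pE dot_lin (bigD1 k)//= [X in _ + X]big1 ?addr0 => [|j jk].
  rewrite mxE (dot_normal_edge _ xk) (face_jacobian xk).
  have := face_flux_gt0 xc xk; have := facet_rate_gt0 H k e xc.
  move=> /gt_eqF/negbT r0 /gt_eqF/negbT; rewrite mulf_eq0 negb_or => /andP[s0 f0].
  by field; rewrite r0 f0 s0.
by rewrite (dot_normal_edge0 _ jk xk) mulr0.
Qed.

Lemma piola_solves (v : 'rV[R]_3 -> 'rV[R]_3) k e (a b : 'I_3) (l m : nat) (c : R) :
  (forall x, has_div v x 0) ->
  (forall x j e', x 0 j = e'%:R -> (j, e') != (k, e) -> v x 0 j = 0) ->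
  (forall x, ref_cube x -> x 0 k = e%:R ->
     v x 0 k = face_flux k e x * (F x 0 a ^+ l * F x 0 b ^+ m - c)) ->
  divergence_free H (piola H v) /\
  normal_flux_condition H (face_index k e) a b l m c (piola H v).
Proof.
move=> vdiv v0 vface; split; first exact: piola_divergence_free.
split=> [z zf|f z].
  have [xc xz xk] := hex_face_ref zf.
  rewrite piola_flux// vface// xz mulrAC mulfV ?mul1r//.
  by have := face_flux_gt0 xc xk; move=> /gt_eqF/negbT; rewrite mulf_eq0 negb_or => /andP[].
have [k' [e' ->]] := face_indexP f => ne zf.
have [xc xz xk] := hex_face_ref zf.
rewrite piola_flux// (v0 _ _ _ xk) ?mul0r//.
by apply: contra ne => /eqP[-> ->].
Qed.

End Piola.

(** * Polynomial fields on the cube *)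

Section PolynomialFunctions.
Context {R : realType}.
Implicit Types (u w : 'rV[R]_3 -> R).

Definition polynomial_fun u : Prop :=
  exists P : mpoly.mpoly 3 R, forall x, u x = mpoly.meval (fun k => x 0 k) P.

Lemma polynomial_fieldP (v : 'rV[R]_3 -> 'rV[R]_3) :
  (forall j, polynomial_fun (fun x => v x 0 j)) -> polynomial_field v.
Proof.
by move=> /choice[P vP]; exists P => x; apply/rowP => j; rewrite mxE vP.
Qed.

Lemma polynomial_cst c : polynomial_fun (fun=> c).
Proof. by exists (mpoly.mpolyC 3 c) => x; rewrite mpoly.mevalC. Qed.

Lemma polynomial_coord j : polynomial_fun (fun x => x 0 j).
Proof.
by exists (mpoly.mpolyX R (mpoly.mnm1 j)) => x; rewrite mpoly.mevalXU.
Qed.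

Lemma polynomialD u w : polynomial_fun u -> polynomial_fun w ->
  polynomial_fun (fun x => u x + w x).
Proof. by move=> [P uP] [Q wQ]; exists (P + Q) => x; rewrite mpoly.mevalD uP wQ. Qed.

Lemma polynomialM u w : polynomial_fun u -> polynomial_fun w ->
  polynomial_fun (fun x => u x * w x).
Proof. by move=> [P uP] [Q wQ]; exists (P * Q) => x; rewrite mpoly.mevalM uP wQ. Qed.

Lemma polynomialB u w : polynomial_fun u -> polynomial_fun w ->
  polynomial_fun (fun x => u x - w x).
Proof. by move=> [P uP] [Q wQ]; exists (P - Q) => x; rewrite mpoly.mevalB uP wQ. Qed.

Lemma eq_polynomial u w : u =1 w -> polynomial_fun w -> polynomial_fun u.
Proof. by move=> /funext ->. Qed.

Lemma polynomialX u n : polynomial_fun u -> polynomial_fun (fun x => u x ^+ n).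
Proof.
move=> uP; elim: n => [|n IH].
  by under eq_fun do rewrite expr0; exact: polynomial_cst.
by under eq_fun do rewrite exprS; exact: polynomialM.
Qed.

Lemma polynomial_sum (I : Type) (r : seq I) (u : I -> 'rV[R]_3 -> R) :
  (forall i, polynomial_fun (u i)) -> polynomial_fun (fun x => \sum_(i <- r) u i x).
Proof.
move=> uP; elim: r => [|i r IH].
  by under eq_fun do rewrite big_nil; exact: polynomial_cst.
by under eq_fun do rewrite big_cons; exact: polynomialD.
Qed.

End PolynomialFunctions.

Section Shapes.
Context {R : realType}.
Implicit Types (x y : 'rV[R]_3) (k j : 'I_3) (e : bool) (p q n : nat) (s t : R).

(** The functions that replace the monomials: those other than 1 are centred so
    that their integral over the unit square is 0. *)
Definition moment p q s t : R :=
  if (p + q == 0)%N then 1 else s ^+ p * t ^+ q - 1 / (p.+1%:R * q.+1%:R).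

Definition bubble p q s t : R :=
  1 / (2 * p.+1%:R) * s * (1 - s ^+ p) * (t ^+ q + 1 / q.+1%:R).

(** The field psi_pq of the face x_k = e.  Its k-th component is carried by
    x_k - (1 - e), which vanishes on the opposite face and has derivative 1; the
    two other components compensate the divergence and vanish at both ends of
    their axis.  For p = q = 0 they are 0, and the divergence is 1. *)
Definition shape k e p q x : 'rV[R]_3 :=
  \row_j if j == k then (if e then x 0 k else x 0 k - 1) * moment p q (x 0 (k + 1)) (x 0 (k + 2))
         else if j == k + 1 then bubble p q (x 0 (k + 1)) (x 0 (k + 2))
         else bubble q p (x 0 (k + 2)) (x 0 (k + 1)).

Lemma bubble0 p q s t : s = 0 \/ s = 1 -> bubble p q s t = 0.
Proof.
by rewrite /bubble => -[] ->; rewrite ?expr1n ?subrr !(mulr0, mul0r).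
Qed.

Lemma psi1E p q x : psi1 p q x = shape 0 true p q x.
Proof.
rewrite /psi1; case: ifPn => pq; apply: row3P; rewrite !mxE /= !ord3_addE //.
- by rewrite /moment pq mulr1.
- by move: pq; rewrite addn_eq0 => /andP[/eqP-> _]; rewrite /bubble expr0 subrr mulr0 mul0r.
- by move: pq; rewrite addn_eq0 => /andP[_ /eqP->]; rewrite /bubble expr0 subrr mulr0 mul0r.
by rewrite /moment (negbTE pq); ring.
Qed.

Lemma polynomial_moment p q (u w : 'rV[R]_3 -> R) :
  polynomial_fun u -> polynomial_fun w ->
  polynomial_fun (fun x => moment p q (u x) (w x)).
Proof.
move=> uP wP; rewrite /moment; case: (p + q == 0)%N; first exact: polynomial_cst.
apply: polynomialB; last exact: polynomial_cst.
by apply: polynomialM; exact: polynomialX.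
Qed.

Lemma polynomial_bubble p q (u w : 'rV[R]_3 -> R) :
  polynomial_fun u -> polynomial_fun w ->
  polynomial_fun (fun x => bubble p q (u x) (w x)).
Proof.
move=> uP wP; rewrite /bubble; apply: polynomialM; last first.
  by apply: polynomialD; [exact: polynomialX|exact: polynomial_cst].
apply: polynomialM; first by apply: polynomialM => //; exact: polynomial_cst.
by apply: polynomialB; [exact: polynomial_cst|exact: polynomialX].
Qed.

Lemma polynomial_shape k e p q j : polynomial_fun (fun x => shape k e p q x 0 j).
Proof.
apply: eq_polynomial (fun x => mxE _ _ _ _) _.
case: (j == k); last by case: (j == k + 1); apply: polynomial_bubble; exact: polynomial_coord.
apply: polynomialM; last by apply: polynomial_moment; exact: polynomial_coord.
case: e; first exact: polynomial_coord.
by apply: polynomialB; [exact: polynomial_coord|exact: polynomial_cst].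
Qed.

Lemma has_grad_bubble p q i j x : i != j ->
  exists2 g, has_grad (fun y => bubble p q (y 0 i) (y 0 j)) x g &
    g i = (1 / p.+1%:R - x 0 i ^+ p) * (x 0 j ^+ q + 1 / q.+1%:R) / 2.
Proof.
move=> ij; eexists.
  apply: (@eq_has_grad _ _ _ _ _ _ _ (frefl _)
    (has_gradM (has_gradM (has_grad_cst (1 / (2 * p.+1%:R)) x)
      (has_gradD (has_grad_coord i x)
        (has_gradM (has_grad_cst (-1) x) (has_gradX p.+1 (has_grad_coord i x)))))
      (has_gradD (has_gradX q (has_grad_coord j x)) (has_grad_cst (1 / q.+1%:R) x)))).
  by move=> y /=; rewrite /bubble exprS; ring.
rewrite /= eqxx (negbTE ij) [false%:R]mulr0n [true%:R]mulr1n.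
have : p.+1%:R != 0 :> R by rewrite pnatr_eq0.
have : q.+1%:R != 0 :> R by rewrite pnatr_eq0.
move: (p.+1%:R : R) (q.+1%:R : R) => A B B0 A0.
by field; rewrite A0 B0.
Qed.

(** For p + q > 0, a = s^p, b = t^q and A, B their means, the three diagonal
    derivatives are a b - A B, (A - a)(b + B) / 2 and (B - b)(a + A) / 2, with
    sum 0. *)
Lemma has_div_shape k e p q x : has_div (shape k e p q) x (p + q == 0)%N%:R.
Proof.
pose dg j : R := if j == k then moment p q (x 0 (k + 1)) (x 0 (k + 2))
  else if j == k + 1 then
    (1 / p.+1%:R - x 0 (k + 1) ^+ p) * (x 0 (k + 2) ^+ q + 1 / q.+1%:R) / 2
  else (1 / q.+1%:R - x 0 (k + 2) ^+ q) * (x 0 (k + 1) ^+ p + 1 / p.+1%:R) / 2.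
have k12 : k + 1 != k + 2 by elim/ord3_ind: k {dg}; rewrite !ord3_addE.
have : forall j, exists g, has_grad (fun y => shape k e p q y 0 j) x g /\ g j = dg j.
  move=> j; rewrite (_ : (fun y => _) = fun y => if j == k then
      (if e then y 0 k else y 0 k - 1) * moment p q (y 0 (k + 1)) (y 0 (k + 2))
      else if j == k + 1 then bubble p q (y 0 (k + 1)) (y 0 (k + 2))
      else bubble q p (y 0 (k + 2)) (y 0 (k + 1))); last by apply/funext => y; rewrite mxE.
  rewrite /dg; case: (altP (j =P k)) => [->|jk].
    have wg : has_grad (fun y => if e then y 0 k else y 0 k - 1) x (fun m => (m == k)%:R).
      case: e; first exact: has_grad_coord.
      apply: eq_has_grad (has_gradD (has_grad_coord k x) (has_grad_cst (-1) x)) => // m.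
      by rewrite addr0.
    have [g mg gk] : exists2 g, has_grad
        (fun y => moment p q (y 0 (k + 1)) (y 0 (k + 2))) x g & g k = 0.
      rewrite /moment; case: (p + q == 0)%N; first by exists (fun=> 0) => //; exact: has_grad_cst.
      eexists.
        apply: has_gradD (has_grad_cst _ x).
        exact: has_gradM (has_gradX p (has_grad_coord _ x)) (has_gradX q (has_grad_coord _ x)).
      rewrite /= (_ : k == k + 1 = false) 1?(_ : k == k + 2 = false); first by rewrite ![false%:R]mulr0n; ring.
        by elim/ord3_ind: k {dg k12 wg}; rewrite !ord3_addE.
      by elim/ord3_ind: k {dg k12 wg}; rewrite !ord3_addE.
    eexists; split; first exact: has_gradM wg mg.
    by rewrite /= gk eqxx mulr0 add0r mul1r.
  case: (altP (j =P k + 1)) => [->|jk1].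
    by have [g gP gE] := has_grad_bubble p q x k12; exists g.
  have -> : j = k + 2.
    by move: j k jk jk1 {dg k12}; elim/ord3_ind; elim/ord3_ind; rewrite !ord3_addE.
  rewrite eq_sym in k12.
  by have [g gP gE] := has_grad_bubble q p x k12; exists g.
move=> /choice[g gP]; exists g => [j|]; first exact: (gP j).1.
rewrite (eq_bigr dg); last by move=> j _; exact: (gP j).2.
rewrite sum_ord3 /dg /moment; have rest : (if (p + q == 0)%N then 1 else
     x 0 (k + 1) ^+ p * x 0 (k + 2) ^+ q - 1 / (p.+1%:R * q.+1%:R)) +
   (1 / p.+1%:R - x 0 (k + 1) ^+ p) * (x 0 (k + 2) ^+ q + 1 / q.+1%:R) / 2 +
   (1 / q.+1%:R - x 0 (k + 2) ^+ q) * (x 0 (k + 1) ^+ p + 1 / p.+1%:R) / 2 =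
   (p + q == 0)%N%:R.
  case: ifPn => [|_].
    by rewrite addn_eq0 => /andP[/eqP-> /eqP->]; rewrite !expr0 -[RHS]/(1%:R : R); field.
  have : p.+1%:R != 0 :> R by rewrite pnatr_eq0.
  have : q.+1%:R != 0 :> R by rewrite pnatr_eq0.
  move: (p.+1%:R : R) (q.+1%:R : R) => A B B0 A0.
  by rewrite mulr0n; field; rewrite A0 B0.
rewrite -rest; move: (if (p + q == 0)%N then _ else _) => a.
move: (_ / 2) (_ / 2) => b c.
by elim/ord3_ind: k {dg k12 rest gP}; rewrite !ord3_addE /=; ring.
Qed.

Lemma shape_boundary k e p q x j e' : x 0 j = e'%:R -> (j, e') != (k, e) ->
  shape k e p q x 0 j = 0.
Proof.
move=> xj; rewrite xpair_eqE mxE.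
have e01 : (e'%:R : R) = 0 \/ (e'%:R : R) = 1 by case: e' xj; [right|left].
case: (altP (j =P k)) => [jk /=|jk _].
  by rewrite -jk xj; case: e' {xj e01}; case: e; rewrite //= ?subrr mul0r.
case: (altP (j =P k + 1)) => [jk1|jk1]; first by apply: bubble0; rewrite -jk1 xj.
apply: bubble0; rewrite -(_ : j = k + 2) ?xj//.
by move: j k jk jk1 {xj}; elim/ord3_ind; elim/ord3_ind; rewrite !ord3_addE.
Qed.

Lemma shape_face k e p q x : x 0 k = e%:R -> shape k e p q x 0 k =
  side_sign e * moment p q (x 0 (k + 1)) (x 0 (k + 2)).
Proof.
by move=> xk; rewrite mxE eqxx xk /side_sign; case: e {xk}; rewrite ?sub0r.
Qed.

Definition comb k e n (alpha : 'M[R]_(n.+2)) x : 'rV[R]_3 :=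
  \sum_(p < n.+2) \sum_(q < n.+2) alpha p q *: shape k e p q x.

Definition expansion n (alpha : 'M[R]_(n.+2)) s t : R :=
  \sum_(p < n.+2) \sum_(q < n.+2) alpha p q * moment p q s t.

Lemma combE k e n (alpha : 'M[R]_(n.+2)) x j : comb k e alpha x 0 j =
  \sum_(p < n.+2) \sum_(q < n.+2) alpha p q * shape k e p q x 0 j.
Proof.
rewrite summxE; apply: eq_bigr => p _.
by rewrite summxE; apply: eq_bigr => q _; rewrite mxE.
Qed.

Lemma polynomial_comb k e n (alpha : 'M[R]_(n.+2)) j :
  polynomial_fun (fun x => comb k e alpha x 0 j).
Proof.
apply: eq_polynomial (fun x => combE k e alpha x j) _.
apply: polynomial_sum => p; apply: polynomial_sum => q.
by apply: polynomialM; [exact: polynomial_cst|exact: polynomial_shape].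
Qed.

Lemma sum_delta00 n (f : 'I_n.+1 -> 'I_n.+1 -> R) :
  \sum_p \sum_q f p q * (p + q == 0)%N%:R = f 0 0.
Proof.
rewrite (bigD1 0)//= [X in _ + X]big1 ?addr0 => [|p p0]; last first.
  rewrite big1// => q _.
  by rewrite addn_eq0 -[(p == 0%N :> nat)]/(p == 0) (negbTE p0) mulr0.
rewrite (bigD1 0)//= [X in _ + X]big1 ?addr0 ?mulr1// => q q0.
by rewrite add0n -[(q == 0%N :> nat)]/(q == 0) (negbTE q0) mulr0.
Qed.

Lemma has_div_comb k e n (alpha : 'M[R]_(n.+2)) x :
  has_div (comb k e alpha) x (alpha 0 0).
Proof.
rewrite -[alpha 0 0](sum_delta00 (fun p q : 'I_n.+2 => alpha p q)).
apply: has_div_sum => p; apply: has_div_sum => q.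
exact/has_divZ/has_div_shape.
Qed.

Lemma comb_boundary k e n (alpha : 'M[R]_(n.+2)) x j e' :
  x 0 j = e'%:R -> (j, e') != (k, e) -> comb k e alpha x 0 j = 0.
Proof.
move=> xj ne; rewrite combE big1// => p _; rewrite big1// => q _.
by rewrite (shape_boundary _ _ xj ne) mulr0.
Qed.

Lemma comb_face k e n (alpha : 'M[R]_(n.+2)) x : x 0 k = e%:R ->
  comb k e alpha x 0 k =
  side_sign e * expansion alpha (x 0 (k + 1)) (x 0 (k + 2)).
Proof.
move=> xk; rewrite combE mulr_sumr; apply: eq_bigr => p _.
rewrite mulr_sumr; apply: eq_bigr => q _.
by rewrite shape_face// mulrCA.
Qed.

(** For p and q at most 1, the centred monomials also vanish at the centre of the
    square. *)
Lemma expansion_center (alpha : 'M[R]_2) :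
  expansion (n := 0) alpha 2^-1 2^-1 = alpha 0 0.
Proof.
rewrite /expansion !big_ord_recl !big_ord0 /moment /=.
by rewrite /bump /= ?expr0 ?expr1 ; field.
Qed.

End Shapes.

(** * Expansion of polynomials in the centred monomials *)

Section Expansions.
Context {R : realType}.
Implicit Types (s t : R) (f g : R -> R -> R) (n : nat).

Definition moment_mean (p q : nat) : R := 1 / (p.+1%:R * q.+1%:R).

Lemma momentE p q s t :
  moment p q s t = s ^+ p * t ^+ q - moment_mean p q + (p + q == 0)%N%:R.
Proof.
rewrite /moment /moment_mean; case: ifPn => [|_]; last by rewrite addr0.
by rewrite addn_eq0 => /andP[/eqP-> /eqP->]; rewrite !expr0 -[_%:R in RHS]/(1%:R : R); field.
Qed.

Lemma expansionE n (alpha : 'M[R]_(n.+2)) s t : expansion alpha s t =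
  \sum_p \sum_q alpha p q * (s ^+ p * t ^+ q)
  - \sum_p \sum_q alpha p q * moment_mean p q + alpha 0 0.
Proof.
rewrite -[alpha 0 0](sum_delta00 (fun p q => alpha p q)) -sumrB -big_split.
apply: eq_bigr => p _ /=; rewrite -sumrB -big_split; apply: eq_bigr => q _ /=.
by rewrite momentE; ring.
Qed.

(** Passing from monomials to centred monomials only changes the constant
    coefficient, which becomes the integral m of the polynomial. *)
Lemma expansion_of_monomials n (b : 'I_n.+2 -> 'I_n.+2 -> R) :
  exists alpha : 'M[R]_(n.+2), forall s t,
    expansion alpha s t = \sum_p \sum_q b p q * (s ^+ p * t ^+ q).
Proof.
pose m := \sum_p \sum_q b p q * moment_mean p q.
pose d (p q : 'I_n.+2) : R := (m - b 0 0) * (p + q == 0)%N%:R.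
exists (\matrix_(p, q) (b p q + d p q)) => s t.
have split (f : nat -> nat -> R) : \sum_p \sum_q (\matrix_(p, q) (b p q + d p q)) p q * f p q =
    \sum_p \sum_q b p q * f p q + (m - b 0 0) * f 0%N 0%N.
  rewrite -[X in _ + X](sum_delta00 (fun p q : 'I_n.+2 => (m - b 0 0) * f p q)) -big_split.
  apply: eq_bigr => p _ /=; rewrite -big_split; apply: eq_bigr => q _ /=.
  by rewrite mxE /d; ring.
rewrite expansionE (split (fun p q => s ^+ p * t ^+ q)) (split moment_mean) -/m.
by rewrite !mxE /d /moment_mean -[(_ == _)%N%:R]/(1%:R : R) !expr0; field.
Qed.

(** The n + 1 points i / (n + 1), i <= n, are too many roots. *)
Lemma polynomial_zero n (a : 'I_n.+1 -> R) :
  (forall s, 0 <= s <= 1 -> \sum_p a p * s ^+ p = 0) -> forall p, a p = 0.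
Proof.
move=> a0 p; pose P := \poly_(i < n.+1) a (inord i).
have PE s : P.[s] = \sum_p a p * s ^+ p.
  by rewrite horner_poly; apply: eq_bigr => i _; rewrite inord_val.
suff : P`_p = 0 by rewrite coef_poly ltn_ord inord_val.
pose r (i : nat) : R := i%:R / n.+1%:R.
have n0 : 0 < n.+1%:R :> R by rewrite ltr0n.
suff -> : P = 0 by rewrite coef0.
apply: (@roots_geq_poly_eq0 _ P [seq r i | i <- iota 0 n.+1]).
- apply/allP => x /mapP[i]; rewrite mem_iota add0n => /andP[_ lin] ->.
  rewrite /root PE a0// divr_ge0//= ler_pdivrMr// mul1r ler_nat.
  exact: ltnW.
- rewrite map_inj_uniq ?iota_uniq// => i j /(mulIf _).
  by rewrite invr_eq0 gt_eqF// => /(_ isT) /eqP; rewrite eqr_nat => /eqP.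
- by rewrite size_map size_iota size_poly.
Qed.

Lemma polynomial2_zero n (a : 'I_n.+1 -> 'I_n.+1 -> R) :
  (forall s t, 0 <= s <= 1 -> 0 <= t <= 1 ->
     \sum_p \sum_q a p q * (s ^+ p * t ^+ q) = 0) -> forall p q, a p q = 0.
Proof.
move=> a0 p q; apply: (polynomial_zero (a := a p)) => t t01.
apply: (polynomial_zero (a := fun p => \sum_q a p q * t ^+ q)) => s s01.
rewrite -[RHS](a0 s t)//; apply: eq_bigr => i _; rewrite mulr_suml.
by apply: eq_bigr => j _; ring.
Qed.

(** The difference g of the coefficients expands to 0.  Its monomial coefficients
    are those of g except for the constant one, g_00 + K; as all vanish, only
    g_00 could be nonzero, whence K = 0 and g_00 = 0. *)
Lemma expansion_inj n (alpha beta : 'M[R]_(n.+2)) :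
  (forall s t, 0 <= s <= 1 -> 0 <= t <= 1 -> expansion alpha s t = expansion beta s t) ->
  alpha = beta.
Proof.
move=> ab; pose g := alpha - beta.
pose K := g 0 0 - \sum_p \sum_q g p q * moment_mean p q.
have gE s t : 0 <= s <= 1 -> 0 <= t <= 1 ->
    \sum_p \sum_q (g p q + K * (p + q == 0)%N%:R) * (s ^+ p * t ^+ q) = 0.
  move=> s01 t01; have : expansion g s t = 0.
    rewrite -(subrr (expansion beta s t)) -{1}(ab s t)// /expansion -sumrB.
    apply: eq_bigr => p _; rewrite -sumrB; apply: eq_bigr => q _.
    by rewrite !mxE; ring.
  rewrite expansionE => gst; rewrite -[RHS]gst.
  transitivity (\sum_p \sum_q g p q * (s ^+ p * t ^+ q) + K * (s ^+ 0 * t ^+ 0)).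
    rewrite -[K * (s ^+ 0 * t ^+ 0)](sum_delta00
      (fun p q : 'I_n.+2 => K * (s ^+ p * t ^+ q))) -big_split.
    apply: eq_bigr => p _ /=; rewrite -big_split; apply: eq_bigr => q _ /=; ring.
  by rewrite /K !expr0; ring.
have g0 := polynomial2_zero gE.
have gmean : \sum_p \sum_q g p q * moment_mean p q = g 0 0.
  transitivity (\sum_(p < n.+2) \sum_(q < n.+2) (- K) * moment_mean p q * (p + q == 0)%N%:R).
    apply: eq_bigr => p _; apply: eq_bigr => q _.
    by have /eqP := g0 p q; rewrite addr_eq0 => /eqP ->; ring.
  rewrite (sum_delta00 (fun p q : 'I_n.+2 => - K * moment_mean p q)).
  have /eqP := g0 0 0; rewrite addr_eq0 => /eqP ->.
  by rewrite /moment_mean -[(_ == _)%N%:R]/(1%:R : R); field.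
apply/eqP; rewrite -subr_eq0 -/g; apply/eqP/matrixP => p q; rewrite [RHS]mxE.
by have := g0 p q; rewrite /K gmean subrr mul0r addr0.
Qed.

Definition bidegree_le n f : Prop := exists b : nat -> nat -> R, forall s t,
  f s t = \sum_(p < n.+1) \sum_(q < n.+1) b p q * (s ^+ p * t ^+ q).

(** The coefficients, up to degree n + 1, of the polynomial of degree n with
    coefficients a multiplied by s^i, where i is 0 or 1. *)
Definition shift_coef (i : bool) n (a : nat -> R) (p : nat) : R :=
  if i then (if p is p'.+1 then a p' else 0) else (if (p < n.+1)%N then a p else 0).

Lemma shift_coefE i n a s :
  \sum_(p < n.+2) shift_coef i n a p * s ^+ p = s ^+ i * \sum_(p < n.+1) a p * s ^+ p.
Proof.
case: i => /=.
  rewrite big_ord_recl /= mul0r add0r mulr_sumr; apply: eq_bigr => p _.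
  by rewrite -[_ ^+ true]/s /bump /= exprS; ring.
rewrite -[_ ^+ false]/(1 : R) big_ord_recr /= ltnn mul0r addr0 mul1r; apply: eq_bigr => p _.
by rewrite ltn_ord.
Qed.

Lemma bidegree_shift (i j : bool) n f : bidegree_le n f ->
  bidegree_le n.+1 (fun s t => s ^+ i * t ^+ j * f s t).
Proof.
move=> [b fb]; exists (fun p q => shift_coef i n (fun p => shift_coef j n (b p) q) p).
move=> s t; rewrite exchange_big /=.
transitivity (\sum_(q < n.+2)
    (s ^+ i * \sum_(p < n.+1) shift_coef j n (b p) q * s ^+ p) * t ^+ q).
  rewrite fb -mulrA; under [RHS]eq_bigr do rewrite -mulrA mulr_suml.
  rewrite -mulr_sumr; congr (_ * _); rewrite [RHS]exchange_big mulr_sumr /=.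
  apply: eq_bigr => p _.
  transitivity (s ^+ p * (t ^+ j * \sum_(q < n.+1) b p q * t ^+ q)).
    by rewrite !mulr_sumr; apply: eq_bigr => q _; ring.
  rewrite -(shift_coefE j n (b p) t) mulr_sumr.
  by apply: eq_bigr => q _; ring.
apply: eq_bigr => q _.
rewrite -(shift_coefE i n (fun p => shift_coef j n (b p) q) s) mulr_suml.
by apply: eq_bigr => p _; ring.
Qed.

Lemma bidegreeD n f g : bidegree_le n f -> bidegree_le n g ->
  bidegree_le n (fun s t => f s t + g s t).
Proof.
move=> [b fb] [c gc]; exists (fun p q => b p q + c p q) => s t.
rewrite fb gc -big_split; apply: eq_bigr => p _ /=.
by rewrite -big_split; apply: eq_bigr => q _ /=; ring.
Qed.

Lemma bidegreeZ n c f : bidegree_le n f -> bidegree_le n (fun s t => c * f s t).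
Proof.
move=> [b fb]; exists (fun p q => c * b p q) => s t.
rewrite fb mulr_sumr; apply: eq_bigr => p _.
by rewrite mulr_sumr; apply: eq_bigr => q _; ring.
Qed.

(** Degree at most 1 in each variable, expressed through the corner values. *)
Definition biaffine f : Prop := forall s t, f s t =
  (1 - s) * ((1 - t) * f 0 0 + t * f 0 1) + s * ((1 - t) * f 1 0 + t * f 1 1).

Lemma bidegreeM n f g : biaffine g -> bidegree_le n f ->
  bidegree_le n.+1 (fun s t => g s t * f s t).
Proof.
move=> gE fn.
have S i j c := bidegreeZ c (bidegree_shift i j fn).
have [b bE] := bidegreeD (bidegreeD (S false false (g 0 0)) (S true false (g 1 0 - g 0 0)))
  (bidegreeD (S false true (g 0 1 - g 0 0)) (S true true (g 1 1 - g 1 0 - g 0 1 + g 0 0))).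
exists b => s t; rewrite -bE gE !expr0 !expr1; ring.
Qed.

Lemma bidegree1 : bidegree_le 0 (fun _ _ => 1).
Proof.
exists (fun _ _ => 1) => s t; rewrite !big_ord_recl !big_ord0 /= !expr0; ring.
Qed.

Lemma bidegreeX n f g l : biaffine g -> bidegree_le n f ->
  bidegree_le (l + n) (fun s t => g s t ^+ l * f s t).
Proof.
move=> gE fn; elim: l => [|l [b bE]].
  by have [b bE] := fn; exists b => s t; rewrite expr0 mul1r bE.
have [|c cE] := bidegreeM gE (f := fun s t => g s t ^+ l * f s t) (n := l + n).
  by exists b.
by exists c => s t; rewrite exprS -mulrA cE.
Qed.

End Expansions.

(** * Integrals and derivatives of affine functions *)

Section Area.
Context {R : realType}.

Lemma integral_affine (a b : R) :
  \int[lebesgue_measure]_(t in `[0, 1]) (a + b * t) = a + b / 2.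
Proof.
pose P : R -> R := fun t => a * t + b / 2 * t ^+ 2.
have dP (x : R) : is_derive x 1 P (a + b * x).
  apply: is_derive_eq; rewrite /GRing.scale /=; by field.
rewrite /Rintegral (@continuous_FTC2 _ (fun t => a + b * t) P)//.
- by rewrite -EFinB /= /P; field.
- apply: continuous_subspaceT => x; apply: cvgD; first exact: cvg_cst.
  by apply: cvgM; [exact: cvg_cst|exact: cvg_id].
- have Pc : continuous P.
    move=> x; have /derivable1_diffP/differentiable_continuous : derivable P x 1 by [].
    exact.
  split; first by move=> x _; have := dP x; case.
  + by apply: cvg_at_right_filter; exact: Pc.
  + by apply: cvg_at_left_filter; exact: Pc.
by move=> x _; rewrite derive1E; have := dP x => d; rewrite derive_val.
Qed.

Lemma derive1_affine (c e : 'rV[R]_3) (r s : R) :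
  derive1 (fun s' : R => c + (s' - r) *: e) s = e.
Proof.
rewrite /derive1; apply: cvg_lim => //; apply: cvg_near_cst.
near=> h; rewrite (_ : c + _ - _ = h *: e).
  rewrite scalerA mulVf ?scale1r//; near: h; exact: nbhs_dnbhs_neq.
by apply/rowP => j; rewrite !mxE; ring.
Unshelve. all: by end_near. Qed.

End Area.

(** * Face Jacobians and the solution fields *)

Section FaceExpansions.
Context {R : realType}.
Implicit Types (k : 'I_3) (e : bool) (s t : R) (x : 'rV[R]_3).
Variable H : hexahedron R.
Hypothesis J_gt0 : forall x, ref_cube x -> 0 < hex_jac H x.
Let F := hex_map H.

Definition face_point k e s t : 'rV[R]_3 :=
  \row_j if j == k then e%:R else if j == k + 1 then s else t.

Lemma face_pointE k e s t : ((face_point k e s t 0 k = e%:R)%R *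
  (face_point k e s t 0 (k + 1) = s)%R * (face_point k e s t 0 (k + 2) = t)%R)%type.
Proof. by elim/ord3_ind: k; rewrite !mxE !ord3_addE. Qed.

Lemma face_point_coord k e x : x 0 k = e%:R ->
  face_point k e (x 0 (k + 1)) (x 0 (k + 2)) = x.
Proof.
by move=> xk; elim/ord3_ind: k xk => xk; apply: row3P; rewrite !mxE !ord3_addE /= ?xk.
Qed.

Lemma face_point_cube k e s t :
  0 <= s <= 1 -> 0 <= t <= 1 -> ref_cube (face_point k e s t).
Proof.
move=> s01 t01 j; rewrite mxE; case: ifP => _; last by case: ifP.
by case: e; rewrite ?lexx ?ler01.
Qed.

Lemma set_coord_face_point k e s t r :
  ((set_coord (face_point k e s t) (k + 1) r = face_point k e r t)%R *
   (set_coord (face_point k e s t) (k + 2) r = face_point k e s r)%R)%type.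
Proof.
by split; elim/ord3_ind: k; apply: row3P; rewrite !mxE !ord3_addE.
Qed.

Lemma tri_biaffine c k e : biaffine (fun s t => tri c (face_point k e s t)).
Proof.
move=> s t; rewrite -(set_coord_face_point k e 0 t s).1 tri_set_coord.
rewrite /dtri !(set_coord_face_point k e _ _ _).1.
rewrite -!(set_coord_face_point k e _ 0 t).2 !(tri_set_coord c (k + 2) _ t).
rewrite /dtri !(set_coord_face_point k e _ _ _).2; ring.
Qed.

Lemma hex_map_biaffine k e a : biaffine (fun s t => F (face_point k e s t) 0 a).
Proof. by move=> s t; rewrite !hex_mapE; exact: tri_biaffine. Qed.

Lemma dot_cross_biaffine (n a b c d : 'rV[R]_3) :
  biaffine (fun s t => dot n (cross (a + t *: b) (c + s *: d))).
Proof.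
move=> s t.
have E s' t' : dot n (cross (a + t' *: b) (c + s' *: d)) =
    dot n (cross a c) + t' * dot n (cross b c) + s' * dot n (cross a d)
    + s' * t' * dot n (cross b d).
  have C (u v : 'rV[R]_3) : dot n (cross u v) =
      n 0 0 * (u 0 1 * v 0 2 - u 0 2 * v 0 1) + n 0 1 * (u 0 2 * v 0 0 - u 0 0 * v 0 2)
      + n 0 2 * (u 0 0 * v 0 1 - u 0 1 * v 0 0) by rewrite dotE !crossE.
  have L (u v : 'rV[R]_3) r l : (u + r *: v) 0 l = u 0 l + r * v 0 l by rewrite !mxE.
  by rewrite !C !L; ring.
by rewrite !E; ring.
Qed.

(** On the face, each of the two tangent derivatives of F depends only on the
    variable of the other one, and affinely so. *)
Lemma face_flux_biaffine k e : biaffine (fun s t => face_flux H k e (face_point k e s t)).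
Proof.
pose P s t := face_point k e s t.
have [a [b e1]] : exists a b, forall s t, edge H (k + 1) (P s t) = a + t *: b.
  exists (edge H (k + 1) (P 0 0)), (edge H (k + 1) (P 0 1) - edge H (k + 1) (P 0 0)).
  move=> s t; apply/rowP => l; rewrite !mxE /dtri /P !(set_coord_face_point k e _ _ _).1.
  by rewrite (tri_biaffine _ k e 1 t) (tri_biaffine _ k e 0 t); ring.
have [c [d e2]] : exists c d, forall s t, edge H (k + 2) (P s t) = c + s *: d.
  exists (edge H (k + 2) (P 0 0)), (edge H (k + 2) (P 1 0) - edge H (k + 2) (P 0 0)).
  move=> s t; apply/rowP => l; rewrite !mxE /dtri /P !(set_coord_face_point k e _ _ _).2.
  by rewrite (tri_biaffine _ k e s 1) (tri_biaffine _ k e s 0); ring.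
move=> s t; rewrite /face_flux -!/(P _ _) !e1 !e2.
exact: dot_cross_biaffine.
Qed.

(** The product of l + m + 1 functions of degree at most 1 in each variable. *)
Lemma face_expansion_exists k e (a b : 'I_3) (l m : nat) :
  exists alpha : 'M[R]_((l + m).+2), forall s t,
    side_sign e * face_flux H k e (face_point k e s t) *
      (F (face_point k e s t) 0 a ^+ l * F (face_point k e s t) 0 b ^+ m) =
    expansion alpha s t.
Proof.
have Fa := hex_map_biaffine k e a; have Fb := hex_map_biaffine k e b.
have B0 := bidegreeX l Fa (bidegreeX m Fb bidegree1).
have B1 := bidegreeZ (side_sign e) (bidegreeM (face_flux_biaffine k e) B0).
rewrite addn0 in B1; have [c cE] := B1.
have [alpha alphaE] := expansion_of_monomials (fun p q : 'I_(l + m).+2 => c p q).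
by exists alpha => s t; rewrite alphaE -cE; ring.
Qed.

(** The two combinations have the constant divergences alpha_00 and alpha0_00,
    and c is chosen so that the divergences cancel.  The sign, which occurs in the
    expansions and in the k-th component of the shapes, cancels out. *)
Lemma expansions_solve k e (a b : 'I_3) (l m : nat)
    (alpha : 'M[R]_((l + m).+2)) (alpha0 : 'M[R]_2) :
  (forall s t, 0 <= s <= 1 -> 0 <= t <= 1 ->
    side_sign e * face_flux H k e (face_point k e s t) *
      (F (face_point k e s t) 0 a ^+ l * F (face_point k e s t) 0 b ^+ m) =
    expansion alpha s t) ->
  (forall s t, 0 <= s <= 1 -> 0 <= t <= 1 ->
    side_sign e * face_flux H k e (face_point k e s t) = expansion (n := 0) alpha0 s t) ->
  let c := alpha 0 0 / alpha0 0 0 in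
  let v := fun x => comb k e alpha x - c *: comb k e (n := 0) alpha0 x in
  [/\ polynomial_field v, divergence_free H (piola H v) &
      normal_flux_condition H (face_index k e) a b l m c (piola H v)].
Proof.
move=> alphaP alpha0P c v.
(* The constant coefficient is the value of the face Jacobian at the centre. *)
have a00 : alpha0 0 0 != 0.
  have half01 : 0 <= (2^-1 : R) <= 1 by rewrite invr_ge0 ler0n invf_le1 ?ler1n ?ltr0n.
  rewrite -expansion_center -alpha0P//.
  apply/lt0r_neq0/(face_flux_gt0 J_gt0); first exact: face_point_cube.
  by rewrite face_pointE.
have vE x j : v x 0 j = comb k e alpha x 0 j - c * comb k e (n := 0) alpha0 x 0 j.
  by rewrite !mxE.
have [] : divergence_free H (piola H v) /\
    normal_flux_condition H (face_index k e) a b l m c (piola H v).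
  apply: piola_solves => // [x|x j e' xj ne|x xc xk].
  - have : has_div v x (alpha 0 0 + (-1) * (c * alpha0 0 0)).
      have := has_divD (has_div_comb k e alpha x)
        (has_divZ (-1) (has_divZ c (has_div_comb k e (n := 0) alpha0 x))).
      by rewrite /v; under [in X in X -> _]eq_fun do rewrite scaleN1r.
    by rewrite /c divfK// mulN1r subrr.
  - by rewrite vE !(comb_boundary _ xj ne) mulr0 subrr.
  rewrite vE !comb_face// -alphaP -?alpha0P//; try exact: xc.
  rewrite face_point_coord//.
  transitivity (side_sign e * side_sign e * (face_flux H k e x * (F x 0 a ^+ l * F x 0 b ^+ m - c))).
    by ring.
  by rewrite side_signK mul1r.
by split => //; apply: polynomial_fieldP => j; apply: eq_polynomial (vE^~ j) _;
  apply: polynomialB; [|apply: polynomialM; first exact: polynomial_cst];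
  exact: polynomial_comb.
Qed.

Lemma vec3_face_point s t : vec3 1 s t = face_point 0 true s t.
Proof. by apply: row3P; rewrite !mxE. Qed.

(** The norm of the cross product, which is a positive multiple of the unit
    normal. *)
Lemma face1_jacE s t : 0 <= s <= 1 -> 0 <= t <= 1 ->
  face1_jac H s t = side_sign true * face_flux H 0 true (face_point 0 true s t).
Proof.
move=> s01 t01; rewrite /face1_jac vec3_face_point !derive_hex_map /side_sign mul1r.
set x := face_point _ _ _ _; have xk : x 0 0 = true%:R by rewrite face_pointE.
have x0 := face_flux_gt0 J_gt0 (face_point_cube 0 true s01 t01) xk.
rewrite /side_sign mul1r in x0; rewrite /enorm.
have := dot_cross_edge H (cross (edge H 1 x) (edge H 2 x)) xk.
rewrite !ord3_addE => ->; rewrite -/(face_flux _ _ _ _).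
by rewrite -expr2 sqrtr_sqr gtr0_norm.
Qed.

Lemma face1_expansionE (a b : 'I_3) (l m : nat) (alpha : 'M[R]_((l + m).+2)) :
  face1_expansion H a b l m alpha <->
  forall s t, 0 <= s <= 1 -> 0 <= t <= 1 ->
    side_sign true * face_flux H 0 true (face_point 0 true s t) *
      (F (face_point 0 true s t) 0 a ^+ l * F (face_point 0 true s t) 0 b ^+ m) =
    expansion alpha s t.
Proof.
have rhsE s t : alpha 0 0 +
    \sum_(p < (l + m).+2) \sum_(q < (l + m).+2 | (0 < p + q)%N)
      alpha p q * (s ^+ p * t ^+ q - 1 / (p.+1%:R * q.+1%:R)) = expansion alpha s t.
  rewrite -[alpha 0 0](sum_delta00 (fun p q => alpha p q)) -big_split.
  apply: eq_bigr => p _ /=; rewrite [X in _ + X]big_mkcond -big_split.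
  apply: eq_bigr => q _ /=; rewrite /moment lt0n.
  by case: eqP => _ /=; rewrite ?mulr1 ?addr0 ?mulr0 ?add0r.
split=> expn s t s01 t01; have := expn s t s01 t01.
  by rewrite rhsE /= face1_jacE// vec3_face_point.
by rewrite rhsE /= face1_jacE// vec3_face_point.
Qed.

Lemma face1_expansion_unique (a b : 'I_3) (l m : nat) :
  exists! alpha : 'M[R]_((l + m).+2), face1_expansion H a b l m alpha.
Proof.
have [alpha alphaP] := face_expansion_exists 0 true a b l m.
exists alpha; split; first by apply/face1_expansionE => s t _ _.
move=> beta /face1_expansionE betaP; apply: expansion_inj => s t s01 t01.
by rewrite -alphaP -betaP.
Qed.

(** The integrand of the area is the face Jacobian, and the centred monomials
    have integral 0. *)
Lemma face1_areaE (alpha0 : 'M[R]_2) :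
  (forall s t, 0 <= s <= 1 -> 0 <= t <= 1 ->
    side_sign true * face_flux H 0 true (face_point 0 true s t) =
    expansion (n := 0) alpha0 s t) ->
  face1_area H = alpha0 0 0.
Proof.
move=> alpha0P.
have E s t : expansion (n := 0) alpha0 s t =
    alpha0 0 0 + alpha0 0 1 * (t - 2^-1) + alpha0 1 0 * (s - 2^-1)
    + alpha0 1 1 * (s * t - 4^-1).
  rewrite /expansion !big_ord_recl !big_ord0 /moment /= /bump /=.
  have -> : lift 0 0 = 1 :> 'I_2 by apply: val_inj.
  by rewrite !expr0 !expr1; field.
have integrandE s t : 0 <= s <= 1 -> 0 <= t <= 1 ->
    enorm (cross (derive1 (fun s' => hex_map H (vec3 1 s' t)) s)
                 (derive1 (fun t' => hex_map H (vec3 1 s t')) t)) =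
    expansion (n := 0) alpha0 s t.
  move=> s01 t01; rewrite -(alpha0P s t s01 t01).
  rewrite -(face1_jacE s01 t01).
  rewrite /face1_jac.
  rewrite !derive_hex_map.
  set x := vec3 1 s t.
  have -> : (fun s' => hex_map H (vec3 1 s' t)) =
      (fun s' => hex_map H x + (s' - x 0 1) *: edge H 1 x).
    apply/funext => s'; rewrite -hex_map_set_coord; congr (hex_map H _).
    by apply: row3P; rewrite !mxE.
  have -> : (fun t' => hex_map H (vec3 1 s t')) =
      (fun t' => hex_map H x + (t' - x 0 2) *: edge H 2 x).
    apply/funext => t'; rewrite -hex_map_set_coord; congr (hex_map H _).
    by apply: row3P; rewrite !mxE.
  by rewrite !derive1_affine.
rewrite /face1_area /surface_area.
transitivity (\int[lebesgue_measure]_(s in `[0, 1])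
    (alpha0 0 0 - alpha0 1 0 / 2 - alpha0 1 1 / 4 + (alpha0 1 0 + alpha0 1 1 / 2) * s)).
  apply: eq_Rintegral => s; rewrite inE /= in_itv /= => s01.
  transitivity (\int[lebesgue_measure]_(t in `[0, 1])
    (alpha0 0 0 - alpha0 0 1 / 2 + alpha0 1 0 * (s - 2^-1) - alpha0 1 1 / 4
     + (alpha0 0 1 + alpha0 1 1 * s) * t)).
    apply: eq_Rintegral => t; rewrite inE /= in_itv /= => t01.
    by rewrite integrandE// E; field.
  by rewrite integral_affine; field.
by rewrite integral_affine; field.
Qed.

Lemma sigma1_hatE n (alpha : 'M[R]_(n.+2)) (alpha0 : 'M[R]_2) x :
  sigma1_hat H alpha alpha0 x =
  comb 0 true alpha x - (alpha 0 0 / face1_area H) *: comb 0 true (n := 0) alpha0 x.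
Proof.
have E N (beta : 'M[R]_(N.+2)) : psi1_comb beta x = comb 0 true beta x.
  apply: eq_bigr => p _; apply: eq_bigr => q _; by rewrite psi1E.
by rewrite /sigma1_hat !E.
Qed.

End FaceExpansions.

Theorem mainTheorem1 (R : realType) (H : hexahedron R)
    (J_gt0 : forall xh : 'rV[R]_3, ref_cube xh -> 0 < hex_jac H xh)
    (l m : nat) (n_ge1 : (1 <= l + m)%N) :
  (forall (i : 'I_6) (a b : 'I_3), face_coordinates H i a b ->
     exists (sigma_hat : 'rV[R]_3 -> 'rV[R]_3) (c : R),
       [/\ polynomial_field sigma_hat,
           divergence_free H (piola H sigma_hat) &
           normal_flux_condition H i a b l m c (piola H sigma_hat)])
  /\
  (forall a b : 'I_3, face_coordinates H (inord 1) a b ->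
     [/\ exists! alpha : 'M[R]_((l + m).+2), face1_expansion H a b l m alpha,
         exists! alpha0 : 'M[R]_2, face1_expansion H a b 0 0 alpha0 &
         forall (alpha : 'M[R]_((l + m).+2)) (alpha0 : 'M[R]_2),
           face1_expansion H a b l m alpha ->
           face1_expansion H a b 0 0 alpha0 ->
           let sigma_hat := sigma1_hat H alpha alpha0 in
           exists c : R,
             [/\ polynomial_field sigma_hat,
                 divergence_free H (piola H sigma_hat) &
                 normal_flux_condition H (inord 1) a b l m c
                   (piola H sigma_hat)]]).
Proof.
split=> [i a b _|a b _].
  have [k [e ->]] := face_indexP i.
  have [alpha alphaP] := face_expansion_exists H k e a b l m.
  have [alpha0 alpha0P] := face_expansion_exists H k e a b 0 0.
  have solves := @expansions_solve R H J_gt0 k e a b l m alpha alpha0.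
  eexists; eexists; apply: solves => s t _ _; first exact: alphaP.
  by rewrite -alpha0P !expr0 !mulr1.
split; [exact: face1_expansion_unique|exact: (@face1_expansion_unique _ _ J_gt0 a b 0 0)|].
move=> alpha alpha0 /(face1_expansionE J_gt0) alphaP /(face1_expansionE J_gt0) alpha0P.
have {}alpha0P s t : 0 <= s <= 1 -> 0 <= t <= 1 ->
    side_sign true * face_flux H 0 true (face_point 0 true s t) =
    expansion (n := 0) alpha0 s t.
  by move=> s01 t01; rewrite -alpha0P// !expr0 !mulr1.
rewrite (_ : inord 1 = face_index 0 true)//.
rewrite (_ : sigma1_hat H alpha alpha0 = fun x => comb 0 true alpha x -
    (alpha 0 0 / alpha0 0 0) *: comb 0 true (n := 0) alpha0 x); last first.
  by apply/funext => x; rewrite sigma1_hatE (face1_areaE J_gt0 alpha0P).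
by exists (alpha 0 0 / alpha0 0 0); apply: expansions_solve.
Qed.
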